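(* Let $U$ be a standard normal random variable, $U\sim\mathcal{N}(0,1)$, and let $\alpha\in(0,1)$. Then $$|U|\overset{\mathcal{L}}{=}|U|^{\alpha}X_{\alpha},$$ where $X_\alpha$ is a positive random variable, independent of $U$, with density function $$\rho_{X_{\alpha}}(t)=2^{(1+\alpha)/2}\,W_{-\alpha,(1-\alpha)/2}\left(-2^{\alpha-1}t^{2}\right),\quad t>0.$$ (In particular, this function is a probability density on $(0,\infty)$.)
   Context: $\overset{\mathcal{L}}{=}$ denotes equality in law. For $\lambda>-1$ and $\mu\in\mathbb{C}$, the Wright function is the entire function $$W_{\lambda,\mu}(z):=\sum_{n=0}^{\infty}\frac{z^{n}}{n!\,\Gamma(\lambda n+\mu)},$$ with the convention $1/\Gamma(x)=0$ when $x\in\{0,-1,-2,\dots\}$. *)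

(* Defs.v *)
From HB Require Import structures.
From mathcomp Require Import all_boot all_order all_algebra.
From mathcomp Require Import all_classical all_reals all_analysis.

Set Implicit Arguments.
Unset Strict Implicit.
Unset Printing Implicit Defensive.

Import Order.TTheory GRing.Theory Num.Theory.
Import numFieldNormedType.Exports.

Local Open Scope classical_set_scope.
Local Open Scope ring_scope.

Section Wright.
Context {R : realType}.
Implicit Types (x z lambda mu : R) (n : nat).

(* Euler's integral of the second kind; it is the Gamma function for 0 < x. *)
Definition euler_gamma x : R :=
  \int[lebesgue_measure]_(t in `]0, +oo[) (t `^ (x - 1) * expR (- t)).

(* The least n such that 0 < x + n. *)
Definition gamma_shift x : nat :=
  if 0 < x then 0%N else (Num.truncn (- x)).+1.

(* The Gamma function on the real line, continued to x <= 0 by the functional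
   equation Gamma (x + n) = x (x + 1) ... (x + n - 1) Gamma x.  The value at
   the poles 0, -1, -2, ... is irrelevant: see [rgamma]. *)
Definition gamma x : R :=
  euler_gamma (x + (gamma_shift x)%:R) /
  \prod_(k < gamma_shift x) (x + k%:R).

(* 1 / Gamma, with the convention that it vanishes at 0, -1, -2, ... *)
Definition rgamma x : R :=
  if (x \is a Num.int) && (x <= 0) then 0 else (gamma x)^-1.

(* The Wright function for real mu and z. *)
Definition wright lambda mu z : R :=
  limn (series (fun n => z ^+ n / n`!%:R * rgamma (lambda * n%:R + mu))).

End Wright.

Section Laws.
Context {R : realType}.
Local Open Scope ereal_scope.

(* [f], restricted to [D], is a probability density with respect to the
   Lebesgue measure; its values outside [D] play no role. *)
Definition is_pdf_on (D : set R) (f : R -> R) : Prop :=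
  [/\ measurable_fun D f, (forall t, D t -> (0 <= f t)%R) &
      \int[lebesgue_measure]_(t in D) (f t)%:E = 1].

Context d {T : measurableType d} (P : probability T R).

(* The law of X is absolutely continuous with density [f] on [D], 0 elsewhere. *)
Definition has_density_on (X : {RV P >-> R}) (D : set R) (f : R -> R) : Prop :=
  forall A : set R, measurable A ->
    distribution P X A = \int[lebesgue_measure]_(t in A `&` D) (f t)%:E.

(* [normal_prob m s] has mean m and standard deviation s.  Laws are compared
   on measurable sets only: as functions on all sets they may differ. *)
Definition standard_normal (U : {RV P >-> R}) : Prop :=
  forall A : set R, measurable A -> distribution P U A = normal_prob 0%R 1%R A.

Definition independent_RV (X Y : {RV P >-> R}) : Prop :=
  forall A B : set R, measurable A -> measurable B ->
    P (X @^-1` A `&` Y @^-1` B) = P (X @^-1` A) * P (Y @^-1` B).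

(* Meant for measurable V and W; stated on plain functions so that it applies
   directly to expressions in random variables. *)
Definition eq_in_law (V W : T -> R) : Prop :=
  forall A : set R, measurable A -> pushforward P V A = pushforward P W A.

End Laws.

Definition rho {R : realType} (alpha t : R) : R :=
  2 `^ ((1 + alpha) / 2) *
  wright (- alpha) ((1 - alpha) / 2) (- (2 `^ (alpha - 1)) * t ^+ 2).

Definition normal_and_factor {R : realType} (alpha : R) d
    {T : measurableType d} (P : probability T R) (U X : {RV P >-> R}) : Prop :=
  [/\ standard_normal U,
      {ae P, forall w, 0 < X w},
      independent_RV U X &
      has_density_on X `]0, +oo[ (rho alpha)].

(* Main.v *)
(* Put mu = (1 - alpha) / 2 and W = W_(-alpha, mu).  For 0 <= w <= 1 the power
   series (1 - w (1 - z)^alpha)^m (1 - z)^(-mu) has nonnegative coefficients,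
   because 1 - (1 - z)^alpha and (1 - z)^(-mu) do.  By Gauss's limit for 1 / Gamma
   the coefficient of index floor (v m) for w = x m^(alpha - 1), multiplied by
   m^(1 - mu), tends to v^(mu - 1) W (- x v^(-alpha)), so this limit is
   nonnegative.  Evaluating the generating function at z = 1 - 1 / m gives
   (1 - x / m)^m, whence in the limit
     int_0^oo e^(-v) v^(mu - 1) W (- x v^(-alpha)) dv = e^(-x).
   With x = y^2 / 2 and v = u^2 / 2 and phi the normal density, this reads
     int_0^oo phi(u) rho(y u^(-alpha)) u^(-alpha) du = phi(y)   (y > 0),
   i.e. u^alpha x has density phi in y when (u, x) has density phi(u) rho(x).
   By Tonelli this gives at once the total mass of rho and the identity in law. *)

Require Import Defs.
From HB Require Import structures.
From mathcomp Require Import all_boot all_order all_algebra.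
From mathcomp Require Import all_classical all_reals all_analysis.
From mathcomp Require Import measurable_realfun ring lra.

Set Implicit Arguments.
Unset Strict Implicit.
Unset Printing Implicit Defensive.

Import Order.TTheory GRing.Theory Num.Theory.
Import numFieldNormedType.Exports.

Local Open Scope classical_set_scope.
Local Open Scope ring_scope.

(** Two interchanges of limits shape the proof. In the limit of the coefficients, the j-th term
    contains the coefficient of index N of (1 - z)^(a j - mu), of order N^(mu - a j - 1). It has to
    be bounded uniformly in N by something that j! beats; a bound of size about j^(a j) is available
    ([wright_bound]), and a < 1 makes it summable against 1 / j!. In the passage to the Laplace
    integral, dominated convergence works only on [d, +oo): as v -> 0 the argument - x v^(-a) of W
    runs to - oo, where the power series gives no useful bound. The mass near 0 is controlled by
    nonnegativity instead: it allows a comparison with the generating function at 1 - K / m for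
    another K, which is known in closed form, and the result is of order d^mu. The scale w = x m^(a
    - 1) is the one for which C(m, j) w^j, close to x^j m^(a j) / j!, cancels the powers of m in the
    coefficient of index v m. Up to the Laplace transform mu is any number in (0, 1); the value (1 -
    a) / 2 enters with the normal density. *)

(** * Coefficients of binomial series *)

(* The coefficient of z^N in (1 - z)^(-b). *)
HB.lock Definition rising_coef {R : realType} (b : R) (N : nat) : R :=
  (\prod_(k < N) (b + k%:R)) / N`!%:R.

Section rising_coef.
Context {R : realType}.
Implicit Types (a b c w : R) (m n N k : nat).

Lemma rising_coef0 b : rising_coef b 0 = 1.
Proof. by rewrite unlock big_ord0 fact0 divr1. Qed.

Lemma rising_coefS b N :
  rising_coef b N.+1 = rising_coef b N * (b + N%:R) / N.+1%:R.
Proof.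
rewrite unlock big_ord_recr/= factS natrM.
by field; rewrite nat1r !pnatr_eq0 andTb -lt0n fact_gt0.
Qed.

(** The derivative of (1 - z)^(-b) is b (1 - z)^(-b - 1), read off coefficientwise. *)
Lemma rising_coef_shift b N :
  N.+1%:R * rising_coef b N.+1 = b * rising_coef (b + 1) N.
Proof.
elim: N => [|N IH].
  by rewrite rising_coefS !rising_coef0 addr0 mul1r divr1 mul1r mulr1.
rewrite rising_coefS mulrC divfK ?pnatr_eq0// [in RHS]rising_coefS.
rewrite 2!(mulrA b) -IH.
have -> : N.+1%:R = N%:R + 1 :> R by rewrite -natr1.
have : N%:R + 1 != 0 :> R by rewrite natr1 pnatr_eq0.
by move=> ?; field.
Qed.

(** Coefficient form of (1 - z)^(-b) = (1 - z) (1 - z)^(-b - 1). *)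
Lemma rising_coef_pascal b N :
  rising_coef b N.+1 = rising_coef (b + 1) N.+1 - rising_coef (b + 1) N.
Proof.
apply: (mulfI (_ : N.+1%:R != 0 :> R)); first by rewrite pnatr_eq0.
rewrite rising_coef_shift [in RHS]rising_coefS.
have -> : N.+1%:R = N%:R + 1 :> R by rewrite -natr1.
have : N%:R + 1 != 0 :> R by rewrite natr1 pnatr_eq0.
by move=> ?; field.
Qed.

(* (1 - z)^(-a) (1 - z)^(-b) = (1 - z)^(-(a + b)) *)
Lemma rising_coefD a b N : rising_coef (a + b) N =
  \sum_(k < N.+1) rising_coef a k * rising_coef b (N - k).
Proof.
elim: N => [|N IH]; first by rewrite big_ord1 !rising_coef0 mulr1.
have rec c k : k.+1%:R * rising_coef c k.+1 = (c + k%:R) * rising_coef c k.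
  by rewrite rising_coefS mulrC divfK ?pnatr_eq0// mulrC.
apply: (mulfI (_ : N.+1%:R != 0 :> R)); first by rewrite pnatr_eq0.
rewrite rec IH !mulr_sumr.
(* Leibniz rule: a + b + N is split as (a + k) + (b + N - k), and each part raises one of the two
   indices. *)
transitivity (\sum_(k < N.+1) (k.+1%:R * rising_coef a k.+1 *
    rising_coef b (N - k)) + \sum_(k < N.+1) (rising_coef a k *
    ((N - k).+1%:R * rising_coef b (N - k).+1))).
  rewrite -big_split/=; apply: eq_bigr => k _; rewrite !rec natrB; last by rewrite -ltnS.
  ring.
(* After reindexing, the weights k and N + 1 - k add up to the factor N + 1 on the left. *)
transitivity (\sum_(k < N.+2) (k%:R * rising_coef a k *
    rising_coef b (N.+1 - k)) + \sum_(k < N.+2) (rising_coef a k *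
    ((N.+1 - k)%:R * rising_coef b (N.+1 - k)))).
  congr (_ + _).
    by rewrite [RHS]big_ord_recl/= !mul0r add0r; apply: eq_bigr.
  rewrite [RHS]big_ord_recr/= subnn mul0r mulr0 addr0.
  by apply: eq_bigr => k _; rewrite subSn// -ltnS.
rewrite -big_split/=; apply: eq_bigr => k _; rewrite natrB; last by rewrite -ltnS.
ring.
Qed.

Lemma rising_coef_ge0 b N : 0 <= b -> 0 <= rising_coef b N.
Proof.
by move=> b0; rewrite unlock divr_ge0// prodr_ge0// => k _; rewrite addr_ge0.
Qed.

(** Only the factor k = 0 of the product, which is - a, is nonpositive. Hence 1 - (1 - z)^a has
    nonnegative coefficients. *)
Lemma rising_coef_le0 a N : 0 <= a <= 1 -> rising_coef (- a) N.+1 <= 0.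
Proof.
move=> /andP[a0 a1]; rewrite unlock big_ord_recl addr0 -mulrA mulNr oppr_le0.
rewrite mulr_ge0// divr_ge0//; apply: prodr_ge0 => k _.
by rewrite lift0 -nat1r addrA addr_ge0// addrC subr_ge0.
Qed.

(* The coefficient of z^N in (1 - w (1 - z)^a)^m (1 - z)^(-b). *)
Definition subord_coef a b w m N : R :=
  \sum_(j < m.+1) 'C(m, j)%:R * (- w) ^+ j * rising_coef (b - a * j%:R) N.

(** One more factor 1 - w (1 - z)^a; multiplication by (1 - z)^a lowers b by a. *)
Lemma subord_coefS a b w m N : subord_coef a b w m.+1 N =
  subord_coef a b w m N - w * subord_coef a (b - a) w m N.
Proof.
rewrite /subord_coef big_ord_recl/= bin0 expr0.
under eq_bigr do rewrite /bump leq0n add1n binS natrD !mulrDl.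
rewrite big_split/= addrA mulr_sumr -sumrN; congr (_ + _).
  rewrite [in RHS]big_ord_recl/= bin0 expr0 big_ord_recr/= bin_small// !mul0r addr0.
  by congr (_ + _); apply: eq_bigr => j _; rewrite /bump leq0n add1n.
apply: eq_bigr => j _; rewrite exprS.
have -> : b - a * j.+1%:R = b - a - a * j%:R by rewrite -nat1r mulrDr mulr1; ring.
by ring.
Qed.

(** Cauchy product with (1 - z)^a. Since b - a may be negative, the induction for positivity has to
    return to the exponent b. *)
Lemma subord_coef_conv a b w m N : subord_coef a (b - a) w m N =
  \sum_(k < N.+1) rising_coef (- a) k * subord_coef a b w m (N - k).
Proof.
rewrite /subord_coef; under [RHS]eq_bigr do rewrite mulr_sumr.
rewrite exchange_big/=; apply: eq_bigr => j _.
have -> : b - a - a * j%:R = - a + (b - a * j%:R) by ring.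
rewrite rising_coefD mulr_sumr; apply: eq_bigr => k _; ring.
Qed.

(* 1 - w (1 - z)^a = (1 - w) + w (1 - (1 - z)^a) has nonnegative coefficients. *)
Lemma subord_coef_ge0 a b w m N : 0 <= a <= 1 -> 0 <= b -> 0 <= w <= 1 ->
  0 <= subord_coef a b w m N.
Proof.
move=> a01 b0 /andP[w0 w1]; elim: m N => [|m IH] N.
  by rewrite /subord_coef big_ord1 bin0 expr0 !mul1r mulr0 subr0 rising_coef_ge0.
rewrite subord_coefS subord_coef_conv big_ord_recl rising_coef0 mul1r subn0.
set S := \sum_(_ < _) _; have S0 : S <= 0.
  rewrite -oppr_ge0 -sumrN sumr_ge0// => k _.
  by rewrite -mulNr mulr_ge0// oppr_ge0 rising_coef_le0.
have -> x : x - w * (x + S) = (1 - w) * x + w * (- S) by ring.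
by rewrite addr_ge0// mulr_ge0// ?subr_ge0// oppr_ge0.
Qed.

End rising_coef.

(** * Bounds on binomial coefficients, uniform in the index *)

Section coef_bound.
Context {R : realType}.
Implicit Types (a b c mu x : R) (n N J k : nat).

Lemma powR1D_le x p : 0 <= x -> 0 <= p -> (1 + x) `^ p <= expR (p * x).
Proof.
move=> x0 p0; have x1 : 0 < 1 + x by rewrite ltr_pwDl.
rewrite /powR gt_eqF// ler_expR ler_wpM2l// le_ln1Dx//.
by rewrite (lt_le_trans _ x0)// ltrN10.
Qed.

(** J is the integer in (b, b + 1]. For k < J the factor satisfies |mu - b + k| <= J - k, and C(J,
    N) is the product of the (J - k) / (k + 1). *)
Lemma rising_coef_le_bin b mu J N : 0 < mu < 1 -> 0 <= b ->
  b < J%:R -> J%:R <= b + 1 -> (N <= J)%N ->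
  `|rising_coef (mu - b) N| <= 'C(J, N)%:R.
Proof.
move=> /andP[mu0 mu1] b0 bJ Jb; elim: N => [|N IH] NJ.
  by rewrite rising_coef0 bin0 normr1.
rewrite rising_coefS !normrM normfV normr_nat ler_pdivrMr ?ltr0n//.
have -> : 'C(J, N.+1)%:R * N.+1%:R = 'C(J, N)%:R * (J%:R - N%:R) :> R.
  by rewrite -natrB ?(ltnW NJ)// -!natrM mulnC mul_bin_left mulnC.
apply: ler_pM => //; first exact/IH/ltnW.
have NJ' : N%:R + 1 <= J%:R :> R by rewrite natr1 ler_nat.
by rewrite ler_norml; apply/andP; split; lra.
Qed.

(* Beyond [J] each further factor 1 - p / k is at most (k / (k + 1)) ^ p. *)
Lemma rising_coef_le_powR b mu J N : 0 < mu < 1 -> 0 <= b ->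
  b < J%:R -> J%:R <= b + 1 -> (J <= N)%N ->
  `|rising_coef (mu - b) N| * N.+1%:R `^ (b + 1 - mu) <= J.+1%:R `^ (b + 1 - mu).
Proof.
move=> mu01 b0 bJ Jb; have /andP[mu0 mu1] := mu01.
elim: N => [|N IH]; first by rewrite leqn0 => /eqP ->; rewrite rising_coef0 normr1 mul1r.
rewrite leq_eqVlt => /predU1P[<-|].
  rewrite ler_piMl ?powR_ge0// (le_trans (rising_coef_le_bin _ _ _ _ (leqnn J)))//.
  by rewrite binn.
rewrite ltnS => JN; apply: le_trans (IH JN).
set p := b + 1 - mu; have p0 : 0 <= p by rewrite /p; lra.
have JN' : J%:R <= N%:R :> R by rewrite ler_nat.
have N0 : (0 : R) < N.+1%:R by rewrite ltr0n.
rewrite rising_coefS !normrM normfV normr_nat -!mulrA ler_wpM2l//.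
have -> : mu - b + N%:R = N.+1%:R - p by rewrite /p -natr1; ring.
rewrite ger0_norm; last by rewrite /p -natr1; lra.
have -> : N.+2%:R = N.+1%:R * (1 + N.+1%:R^-1) :> R.
  by rewrite mulrDr mulr1 divff ?natr1// gt_eqF.
rewrite powRM ?addr_ge0 ?invr_ge0//.
set A := _ `^ p; set B := _ `^ p.
have -> : (N.+1%:R - p) * (N.+1%:R^-1 * (A * B)) =
    (N.+1%:R^-1 * (N.+1%:R - p) * B) * A by ring.
rewrite -[leRHS]mul1r ler_wpM2r ?powR_ge0//.
have -> : N.+1%:R^-1 * (N.+1%:R - p) = 1 - p / N.+1%:R.
  by rewrite mulrBr mulVf ?gt_eqF// mulrC.
have e1 : 1 - p / N.+1%:R <= expR (- (p / N.+1%:R)) by rewrite expR_ge1Dx.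
rewrite (le_trans (ler_wpM2r (powR_ge0 _ _) e1))//.
rewrite expRN mulrC ler_pdivrMr ?expR_gt0// mul1r.
by apply: powR1D_le => //; rewrite invr_ge0.
Qed.

(** Joins the range N <= J, where C(J, N) <= 2^J, to the decay beyond J. *)
Lemma rising_coef_bound b mu J N : 0 < mu < 1 -> 0 <= b ->
  b < J%:R -> J%:R <= b + 1 ->
  `|rising_coef (mu - b) N| * N%:R `^ (b + 1 - mu) <=
    2 ^+ J * J.+1%:R `^ (b + 1 - mu).
Proof.
move=> mu01 b0 bJ Jb; have p0 : 0 <= b + 1 - mu by case/andP: mu01; lra.
have [NJ|JN] := leqP N J.
  apply: ler_pM => //; rewrite ?powR_ge0//.
    apply: (le_trans (rising_coef_le_bin mu01 b0 bJ Jb NJ)).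
    rewrite -natrX ler_nat; have := expnDn 1 1 J; rewrite addn1 => ->.
    rewrite (bigD1 (inord N : 'I_J.+1))//= inordK// !exp1n !muln1.
    exact: leq_addr.
  by rewrite ge0_ler_powR ?nnegrE// ler_nat (leq_trans NJ).
apply: (@le_trans _ _ (J.+1%:R `^ (b + 1 - mu))); last first.
  by rewrite ler_peMl ?powR_ge0// exprn_ege1// ler1n.
apply: le_trans (rising_coef_le_powR mu01 b0 bJ Jb (ltnW JN)).
by rewrite ler_wpM2l// ge0_ler_powR ?nnegrE// ler_nat.
Qed.

(** Up to exponential factors this is n^(a n), which n! beats because a < 1. It dominates the
    normalised coefficients of (1 - z)^(a n - mu) and thereby also their limit 1 / Gamma (mu - a
    n). *)
Definition wright_bound a n : R := 2 ^+ n.+1 * n.+2%:R `^ (a * n%:R + 1).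

Lemma wright_bound_ge0 a n : 0 <= wright_bound a n.
Proof. by rewrite mulr_ge0 ?powR_ge0// exprn_ge0. Qed.

Lemma rising_coef_wright_bound a mu n N : 0 < mu < 1 -> 0 < a < 1 ->
  `|rising_coef (mu - a * n%:R) N| * N%:R `^ (a * n%:R + 1 - mu) <=
    wright_bound a n.
Proof.
move=> mu01 /andP[a0 a1]; have b0 : 0 <= a * n%:R by rewrite mulr_ge0// ltW.
(* J is the integer in (a n, a n + 1]. As a < 1, it is at most n + 1; hence the n + 1 and n + 2 in
   [wright_bound]. *)
pose J := (Num.truncn (a * n%:R)).+1.
have /andP[Jb bJ] := truncn_itv b0.
have bn : a * n%:R <= n%:R by rewrite ler_piMl// ltW.
have Jn : (J <= n.+1)%N by rewrite ltnS -(ler_nat R) (le_trans Jb).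
apply: (le_trans (rising_coef_bound N mu01 b0 bJ _)).
  by rewrite -natr1 lerD2r.
apply: ler_pM; rewrite ?powR_ge0 ?exprn_ge0//.
  by apply: ler_weXn2l; rewrite ?ler1n.
apply: (@le_trans _ _ (n.+2%:R `^ (a * n%:R + 1 - mu))).
  rewrite ge0_ler_powR ?nnegrE ?ler_nat ?ltnS//.
  by case/andP: mu01; lra.
by rewrite ler_powR ?ler1n//; case/andP: mu01; lra.
Qed.

End coef_bound.

(** * Convergence of dominating series and Tannery's theorem *)

Section series_tools.
Context {R : realType}.
Implicit Types (a x p l : R) (n N J k : nat).

Lemma powRD_gt0 x a p : 0 < x -> x `^ (a + p) = x `^ a * x `^ p.
Proof. by move=> x0; rewrite powRD// (gt_eqF x0) implybT. Qed.

Lemma cvg_powR (u : R^nat) l p : 0 < l -> u @ \oo --> l ->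
  (fun n => u n `^ p) @ \oo --> l `^ p.
Proof.
move=> l0 ul; have cp : {for l, continuous (@powR R ^~ p)}.
  apply: differentiable_continuous; apply/derivable1_diffP.
  by apply: derivable_powR; rewrite in_itv/= l0.
exact: (cvg_comp u (@powR R ^~ p) ul cp).
Qed.

Lemma cvg_powR_pinfty p : 0 < p -> (fun n => n.+1%:R `^ (- p) : R) @ \oo --> 0.
Proof.
move=> p0; rewrite (_ : (fun n => _) = (fun n => harmonic n `^ p)).
  apply: ((cvg_at_rightP (@powR R ^~ p) 0 0).1 (powR_cvg0 p0) harmonic).
  by split; [move=> n; exact: harmonic_gt0|exact: cvg_harmonic].
by apply/funext => n; rewrite powRN -(powR_inv1 (powR_ge0 _ _)) powRAC powR_inv1.
Qed.

Lemma root_test (v : R^nat) : (forall n, 0 <= v n) -> v @ \oo --> 0 ->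
  cvgn (series (fun n => v n ^+ n)).
Proof.
move=> v0 /cvgrPdist_le/(_ (2^-1)) [//|N _ vN].
(* Beyond N one has 2 v n <= 1; K absorbs the terms before N, as the comparison must hold from index
   0 on. *)
pose K := \sum_(i < N) (2 * v i) ^+ i + 1.
have S0 : 0 <= \sum_(i < N) (2 * v i) ^+ i.
  by apply: sumr_ge0 => i _; rewrite exprn_ge0// mulr_ge0.
apply: (@series_le_cvg _ _ (geometric K 2^-1)).
- by move=> n; rewrite exprn_ge0.
- by move=> n; rewrite mulr_ge0 ?addr_ge0 ?exprn_ge0.
- move=> n; have -> : v n ^+ n = (2 * v n) ^+ n * 2^-1 ^+ n.
    by rewrite -exprMn mulrAC divff ?mul1r.
  rewrite /geometric/= ler_wpM2r ?exprn_ge0//.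
  have [nN|Nn] := ltnP n N.
    rewrite /K (bigD1 (Ordinal nN))//= -addrA lerDl addr_ge0// sumr_ge0// => i _.
    by rewrite exprn_ge0// mulr_ge0.
  apply: (@le_trans _ _ 1); last by rewrite lerDr.
  rewrite exprn_ile1 ?mulr_ge0//.
  by have := vN n Nn; rewrite sub0r normrN ger0_norm//=; lra.
- by apply: is_cvg_geometric_series; rewrite ger0_norm//; lra.
Qed.

(** A substitute for Stirling's formula: compare with the term of index n + 2 in the exponential
    series at n + 2. *)
Lemma expr_over_fact_le n : n.+2%:R ^+ n / n`!%:R <= expR n.+2%:R :> R.
Proof.
have f0 k : 0 < k`!%:R :> R by rewrite ltr0n fact_gt0.
apply: le_trans (le_trans _ (@expR_ge1Dxn R n.+2%:R n.+1 _)) => //.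
rewrite ler_wpDl// !factS mulnA natrM ler_pdivlMr ?mulr_gt0//.
rewrite mulrCA divfK ?gt_eqF//.
rewrite 2!exprS mulrA ler_wpM2r ?exprn_ge0//.
by rewrite -natrM ler_nat leq_mul2l leqnSn orbT.
Qed.

Lemma is_cvg_wright_bound a x : 0 < a < 1 -> 0 <= x ->
  cvgn (series (fun n => wright_bound a n * x ^+ n / n`!%:R)).
Proof.
move=> /andP[a0 a1] x0.
(* Write (n + 2)^(a n) as (n + 2)^n (n + 2)^(- (1 - a) n). The first factor over n! is at most e^(n
   + 2), and n + 2 <= 2^(n + 1) turns the remaining prefactors into 4^(n + 1). What is left is a
   constant times v(n)^n, where v(n) tends to 0 because a < 1. *)
pose v n : R := 4 * expR 1 * x * n.+2%:R `^ (- (1 - a)).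
have v0 n : 0 <= v n by rewrite !mulr_ge0 ?expR_ge0 ?powR_ge0.
have cv : cvgn (series (fun n => v n ^+ n)).
  apply: root_test => //; rewrite -[0](mulr0 (4 * expR 1 * x)).
  apply: cvgMr; rewrite (cvg_shiftS (fun n => n.+1%:R `^ (- (1 - a)))).
  by apply: cvg_powR_pinfty; rewrite subr_gt0.
apply: (@series_le_cvg _ _ ((4 * expR 2) *: (fun n => v n ^+ n))).
- by move=> n; rewrite !mulr_ge0 ?wright_bound_ge0 ?exprn_ge0.
- by move=> n; rewrite mulr_ge0 ?exprn_ge0 ?mulr_ge0 ?expR_ge0.
- move=> n; have n2 : 0 < n.+2%:R :> R by rewrite ltr0n.
  have E : n.+2%:R `^ (a * n%:R + 1) =
      n.+2%:R * n.+2%:R ^+ n * (n.+2%:R `^ (- (1 - a))) ^+ n :> R.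
    rewrite -(powR_mulrn n (powR_ge0 _ _)) -powRrM -(powR_mulrn n (ltW n2)).
    rewrite -[X in X * _ * _](powRr1 (ltW n2)) -!powRD_gt0//.
    by congr (_ `^ _); ring.
  rewrite /wright_bound E.
  set P := n.+2%:R ^+ n; set Q := _ `^ _.
  have -> : 2 ^+ n.+1 * (n.+2%:R * P * Q ^+ n) * x ^+ n / n`!%:R =
    2 ^+ n.+1 * (n.+2%:R * (P / n`!%:R) * (x * Q) ^+ n) by rewrite exprMn; ring.
  have -> : ((4 * expR 2) *: (fun n0 => v n0 ^+ n0)) n =
    2 ^+ n.+1 * (2 ^+ n.+1 * expR n.+2%:R * (x * Q) ^+ n).
    have -> : expR n.+2%:R = expR 2 * expR 1 ^+ n :> R.
      by rewrite -expRM_natl mulr1 -expRD -natrD add2n.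
    transitivity (4 * expR 2 * (4 * expR 1 * x * Q) ^+ n); first by [].
    have -> : 4 * expR 1 * x * Q = 2 * 2 * expR 1 * (x * Q) by ring.
    by rewrite !exprMn !exprS; ring.
  rewrite ler_wpM2l ?exprn_ge0// ler_wpM2r ?exprn_ge0 ?mulr_ge0 ?powR_ge0//.
  apply: ler_pM => //; first by rewrite mulr_ge0 ?exprn_ge0.
    by rewrite -natrX ler_nat ltn_expl.
  exact: expr_over_fact_le.
- exact: is_cvg_seriesZ.
Qed.

(** Dominated convergence for sums whose length grows with n: the first K terms converge, and the
    remainders of the sum and of the series of l lie under that of the series of g. *)
Lemma tannery (f : nat -> nat -> R) (g l : R^nat) :
  cvgn (series g) -> (\forall n \near \oo, forall j, `|f n j| <= g j) ->
  (forall j, f ^~ j @ \oo --> l j) ->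
  cvgn (series l) /\
  (fun n => \sum_(j < n.+1) f n j) @ \oo --> limn (series l).
Proof.
move=> cg fg fl; have g0 j : 0 <= g j.
  by case: fg => N _ /(_ N (leqnn N)) /(_ j); exact: le_trans.
have lg j : `|l j| <= g j.
  have c : `|f n j| @[n --> \oo] --> `|l j| by apply: cvg_norm; exact: fl.
  rewrite -(cvg_lim _ c)//; apply: limr_le; first by apply/cvg_ex; eexists; exact: c.
  by apply: filterS fg => n; exact.
have cl : cvgn (series l).
  apply: normed_cvg; apply: (series_le_cvg _ g0 _ cg) => // j.
  by rewrite normr_ge0.
split => //; apply/cvgrPdist_le => e e0.
have e3 : 0 < e / 3 by rewrite divr_gt0.
have ndg : nondecreasing_seq (series g).
  by apply/nondecreasing_seqP => n; rewrite seriesSr lerDl.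
have [K lK gK] : exists2 K, `|limn (series l) - series l K| <= e / 3 &
    limn (series g) - series g K <= e / 3.
  have /cvgrPdist_le/(_ _ e3) A := cl; have /cvgrPdist_le/(_ _ e3) B := cg.
  near \oo => K; exists K; first by near: K.
  by apply: le_trans (ler_norm _) _; near: K.
have fK : (fun n => \sum_(0 <= j < K) f n j) @ \oo --> series l K.
  by apply: cvg_big => [|j _]; [exact: add_continuous|exact: fl].
move/cvgrPdist_le : fK => /(_ _ e3) fK.
near=> n; have fgn : forall j, `|f n j| <= g j by near: n.
have Kn : (K <= n.+1)%N by apply: leqW; near: n; exact: nbhs_infty_ge.
rewrite -(big_mkord xpredT (f n)) (big_cat_nat (leq0n K) Kn)//= opprD addrA.
rewrite (_ : limn _ - _ = (limn (series l) - series l K) +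
  (series l K - \sum_(0 <= j < K) f n j)); last by rewrite addrA subrK.
rewrite (le_trans (ler_normB _ _))// (_ : e = e / 3 + e / 3 + e / 3); last by field.
rewrite lerD//; last first.
  rewrite (le_trans (ler_norm_sum _ _ _))//.
  rewrite (le_trans (ler_sum _ (fun j _ => fgn j)))//.
  rewrite -sub_series_geq// (le_trans _ gK)// lerD2r.
  exact: nondecreasing_cvgn_le.
rewrite (le_trans (ler_normD _ _))// lerD//.
by near: n.
Unshelve. all: by end_near. Qed.

End series_tools.

Section exhaustion.
Context {R : realType}.
Notation mu := (@lebesgue_measure R).
Implicit Types (t : R) (n : nat).

(** Compact segments that exhaust the open half-line; integration by parts and substitution are done
    on them. With n + 2 every segment is nondegenerate. *)
Definition posseg n : set R := `[n.+2%:R^-1, n.+2%:R].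

Lemma posseg_sub n : posseg n `<=` `]0, +oo[.
Proof.
move=> t; rewrite /posseg/= !in_itv/= andbT => /andP[+ _].
by apply: lt_le_trans; rewrite invr_gt0.
Qed.

Lemma nondecreasing_posseg : nondecreasing_seq posseg.
Proof.
move=> m n mn; rewrite subsetEset; apply: subset_itv; rewrite bnd_simp.
  by rewrite lef_pV2 ?posrE// ler_nat !ltnS.
by rewrite ler_nat !ltnS.
Qed.

Lemma bigcup_posseg : \bigcup_n posseg n = `]0%R, +oo[%classic.
Proof.
apply/seteqP; split=> [t [n _]|t]; first exact: posseg_sub.
rewrite /= in_itv/= andbT => t0.
pose n := Num.truncn (t + t^-1); have nt : t + t^-1 <= n.+2%:R.
  rewrite (le_trans (ltW (truncnS_gt _)))// ler_nat.
  exact: leqnSn.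
exists n => //; rewrite /posseg/= in_itv/=; apply/andP; split.
  rewrite -[leRHS]invrK lef_pV2 ?posrE ?invr_gt0//.
  by rewrite (le_trans _ nt)// lerDr ltW.
by rewrite (le_trans _ nt)// lerDl invr_ge0 ltW.
Qed.

Lemma cvg_integral_posseg (f : R -> \bar R) : measurable_fun `](0 : R), +oo[ f ->
  (forall t, 0 < t -> (0 <= f t)%E) ->
  (fun n => \int[mu]_(t in posseg n) f t)%E @ \oo -->
    (\int[mu]_(t in `]0%R, +oo[) f t)%E.
Proof.
move=> mf f0; rewrite -bigcup_posseg.
apply: ge0_nondecreasing_set_cvg_integral => //.
- exact: nondecreasing_posseg.
- by move=> n; exact: measurable_itv.
- by move=> n; apply: measurable_funS mf => //; exact: posseg_sub.
- by move=> n t /posseg_sub; rewrite /= in_itv/= andbT; exact: f0.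
Qed.

End exhaustion.

(** * Gauss's limit for the Gamma function *)

Section gamma.
Context {R : realType}.
Notation mu := (@lebesgue_measure R).
Implicit Types (s t x y : R) (n N : nat).

Definition gamma_fun y t : R := t `^ (y - 1) * expR (- t).

Lemma gamma_fun_ge0 y t : 0 <= gamma_fun y t.
Proof. by rewrite mulr_ge0 ?powR_ge0 ?expR_ge0. Qed.

Lemma measurable_gamma_fun y D : measurable_fun D (gamma_fun y).
Proof.
apply: measurable_funTS; apply: measurable_funM.
  exact: measurable_powR.
by apply: measurableT_comp => //; exact: measurable_funN.
Qed.

(** Extended-real form of [euler_gamma], whose real-valued integral would hide divergence behind a
    default value. Finiteness is derived from the functional equation, which is proved first. *)
Definition egamma y : \bar R := (\int[mu]_(t in `]0%R, +oo[) (gamma_fun y t)%:E)%E.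

Lemma egamma_ge0 y : (0 <= egamma y)%E.
Proof. by apply: integral_ge0 => t _; rewrite lee_fin gamma_fun_ge0. Qed.

Lemma powR_one y : 1 `^ y = 1 :> R.
Proof. by rewrite powR1. Qed.

Lemma derivable_LRcontinuous (f : R -> R) x y : x <= y ->
  {in `[x, y], forall t, derivable f t 1} -> derivable_oo_LRcontinuous f x y.
Proof.
move=> xy df; split.
- by move=> t; rewrite in_itv/= => /andP[/ltW xt /ltW ty]; apply: df; rewrite in_itv/= xt.
- apply: cvg_at_right_filter; apply: differentiable_continuous.
  by apply/derivable1_diffP/df; rewrite in_itv/= lexx.
- apply: cvg_at_left_filter; apply: differentiable_continuous.
  by apply/derivable1_diffP/df; rewrite in_itv/= lexx xy.
Qed.

Lemma continuous_powR x y : 0 < x -> {for x, continuous (@powR R ^~ y)}.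
Proof.
move=> x0; apply: differentiable_continuous; apply/derivable1_diffP.
by apply: derivable_powR; rewrite in_itv/= x0.
Qed.

Lemma integral_gamma_fun_by_parts y n :
  (\int[mu]_(t in posseg n) (gamma_fun (y + 1) t)%:E =
   (gamma_fun (y + 1) n.+2%:R^-1 - gamma_fun (y + 1) n.+2%:R)%:E +
   y%:E * \int[mu]_(t in posseg n) (gamma_fun y t)%:E)%E.
Proof.
pose a : R := n.+2%:R^-1; pose b : R := n.+2%:R.
have a0 : 0 < a by rewrite /a invr_gt0.
have ab : a < b.
  by rewrite (@lt_trans _ _ 1)// /a /b ?invf_lt1 ?ltr1n.
have abP x : x \in `[a, b] -> 0 < x by rewrite in_itv/= => /andP[+ _]; exact: lt_le_trans.
pose F t := t `^ y; pose f t := y * t `^ (y - 1).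
pose G t : R := - expR (- t); pose g t : R := expR (- t).
have dF x : x \in `[a, b] -> is_derive x 1 F (f x).
  by move=> /abP x0; exact: is_derive1_powR.
have dG x : is_derive x 1 G (g x).
  by rewrite /G /g; apply: is_derive_eq; rewrite mulrN1 opprK.
have cf : {within `[a, b], continuous f}.
  apply: derivable_within_continuous => x /abP x0.
  apply: derivableM => //; apply: derivable_powR.
  by rewrite in_itv/= x0.
have cg : {within `[a, b], continuous g}.
  by apply: derivable_within_continuous => x _; exact: ex_derive.
have cG : {within `[a, b], continuous G}.
  by apply: derivable_within_continuous => x _; exact: ex_derive.
have := @integration_by_parts R F G f g a b ab cf _ _ cg _ _.
have sub : {subset `]a, b[ <= `[a, b]} by move=> x; exact: subset_itv_oo_cc.
have -> : (\int[mu]_(t in posseg n) (gamma_fun (y + 1) t)%:E =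
    \int[mu]_(t in `[a, b]) (F t * g t)%:E)%E.
  by apply: eq_integral => t _; rewrite /gamma_fun addrK.
move=> ->; last 4 first.
- by apply: derivable_LRcontinuous => [|t /dF ?]; [exact: ltW|exact: ex_derive].
- by move=> t /sub /dF ?; rewrite derive1E derive_val.
- by apply: derivable_LRcontinuous => [|t _]; [exact: ltW|exact: ex_derive].
- by move=> t _; rewrite derive1E derive_val.
have -> : (\int[mu]_(x in `[a, b]) (f x * G x)%:E =
    \int[mu]_(x in `[a, b]) ((- y)%:E * (gamma_fun y x)%:E))%E.
  by apply: eq_integral => t _; rewrite -EFinM /f /G /gamma_fun; congr EFin; ring.
rewrite integralZl//; last first.
  apply: continuous_compact_integrable; first exact: segment_compact.
  apply: derivable_within_continuous => x /abP x0.
  apply: derivableM; last exact: ex_derive.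
  by apply: derivable_powR; rewrite in_itv/= x0.
rewrite EFinN mulNe oppeK; congr (_ + _)%E.
by rewrite /gamma_fun addrK /F /G; congr EFin; ring.
Qed.

Lemma gamma_fun_cvg_pinfty y : (fun n => gamma_fun (y + 1) n.+2%:R) @ \oo --> 0.
Proof.
(* For t >= 1, t^y <= t^(k + 1), and e^t >= t^(k + 2) / (k + 2)! leaves the bound (k + 2)! / t. *)
pose k := Num.truncn y.
have yk : y <= k.+1%:R by rewrite ltW// truncnS_gt.
apply: (@squeeze_cvgr _ _ _ _ (cst 0) (fun n => k.+2`!%:R * harmonic n.+1)).
- near=> n; rewrite gamma_fun_ge0/= /gamma_fun addrK.
  set t : R := n.+2%:R; have t1 : 1 <= t by rewrite ler1n.
  have t0 : 0 < t by rewrite (lt_le_trans ltr01).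
  rewrite expRN ler_pdivrMr ?expR_gt0//.
  apply: (@le_trans _ _ (t ^+ k.+1)).
    by rewrite -(powR_mulrn _ (ltW t0)) ler_powR.
  apply: (@le_trans _ _ (k.+2`!%:R * t^-1 * (t ^+ k.+2 / k.+2`!%:R))).
    rewrite le_eqVlt; apply/orP; left; apply/eqP; rewrite (exprS _ k.+1).
    by field; rewrite gt_eqF//= pnatr_eq0 -lt0n fact_gt0.
  apply: ler_wpM2l; first by rewrite mulr_ge0// invr_ge0 ltW.
  by apply: le_trans (expR_ge1Dxn k.+1 (ltW t0)); rewrite lerDr.
- exact: cvg_cst.
- rewrite -[0](mulr0 k.+2`!%:R); apply: cvgMr.
  by rewrite (cvg_shiftS (fun n => harmonic n : R)); exact: cvg_harmonic.
Unshelve. all: by end_near. Qed.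

Lemma gamma_fun_cvg_0 y : 0 < y ->
  (fun n => gamma_fun (y + 1) n.+2%:R^-1) @ \oo --> 0.
Proof.
move=> y0.
apply: (@squeeze_cvgr _ _ _ _ (cst 0) (fun n => n.+2%:R `^ (- y))).
- near=> n; rewrite gamma_fun_ge0/= /gamma_fun addrK.
  rewrite powRN -(powR_inv1 (powR_ge0 _ _)) powRAC powR_inv1//.
  by rewrite ler_piMr ?powR_ge0// -expR0 ler_expR oppr_le0 invr_ge0.
- exact: cvg_cst.
- by rewrite (cvg_shiftS (fun n => n.+1%:R `^ (- y))); exact: cvg_powR_pinfty.
Unshelve. all: by end_near. Qed.

Lemma egammaS y : 0 < y -> (egamma (y + 1) = y%:E * egamma y)%E.
Proof.
move=> y0; have c z := cvg_integral_posseg (f := fun t => (gamma_fun z t)%:E).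
have cE z : (fun n => \int[mu]_(t in posseg n) (gamma_fun z t)%:E)%E @ \oo --> egamma z.
  apply: c => [|t _]; last by rewrite lee_fin gamma_fun_ge0.
  by apply/measurable_EFinP; exact: measurable_gamma_fun.
suff h : (fun n => \int[mu]_(t in posseg n) (gamma_fun (y + 1) t)%:E)%E @ \oo -->
    (y%:E * egamma y)%E by exact: (cvg_unique _ (cE (y + 1)) h).
rewrite [X in X @ _](funext (integral_gamma_fun_by_parts y)).
rewrite -[X in _ --> X]add0e; apply: cvgeD.
- by [].
- apply: cvg_EFin; first by near=> n.
  rewrite -[0]subr0; apply: cvgB; first exact: gamma_fun_cvg_0.
  exact: gamma_fun_cvg_pinfty.
- by apply: cvgeZl.
Unshelve. all: by end_near. Qed.

Lemma egamma1 : egamma 1 = 1%E.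
Proof.
rewrite -[RHS](integral_exponential_pdf (@ltr01 R)) /egamma.
rewrite integral_itv_obnd_cbnd; last first.
  by apply/measurable_EFinP; exact: measurable_gamma_fun.
rewrite integral_mkcond; apply: eq_integral => t _.
rewrite restrict_EFin; congr EFin; rewrite /exponential_pdf; congr (patch _ _ _ _).
by apply/funext => x; rewrite /gamma_fun subrr powRr0 mulN1r !mul1r.
Qed.

Lemma egammaS_nat n : egamma n.+1%:R = n`!%:R%:E.
Proof.
elim: n => [|n IH]; first exact: egamma1.
by rewrite -natr1 egammaS ?ltr0n// IH factS natrM EFinM.
Qed.

(** For z >= 1 and an integer n >= z - 1, t^(z - 1) <= 1 + t^n, so Gamma z is at most 1 + n!. For
    the other y, an infinite value at y would make y Gamma y, which is Gamma (y + 1), infinite. *)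
Lemma egamma_lty y : 0 < y -> (egamma y < +oo)%E.
Proof.
have H z : 1 <= z -> (egamma z < +oo)%E.
  move=> z1; pose n := Num.truncn z.
  have zn : z - 1 <= n%:R by rewrite lerBlDr natr1 ltW// truncnS_gt.
  apply: (@le_lt_trans _ _ (egamma 1 + egamma n.+1%:R)%E); last first.
    by rewrite egamma1 egammaS_nat -EFinD ltry.
  rewrite /egamma -ge0_integralD//=; first apply: ge0_le_integral => //=.
  - by move=> t _; rewrite lee_fin gamma_fun_ge0.
  - by apply/measurable_EFinP; exact: measurable_gamma_fun.
  - by apply: emeasurable_funD; apply/measurable_EFinP; exact: measurable_gamma_fun.
  - move=> t; rewrite /= in_itv/= andbT => t0; rewrite -EFinD lee_fin /gamma_fun.
    rewrite -mulrDl ler_wpM2r ?expR_ge0// subrr powRr0 -natr1 addrK.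
    have [t1|t1] := leP t 1.
      rewrite ler_wpDr ?powR_ge0// -[leRHS](powR_one (z - 1)).
      by rewrite ge0_ler_powR ?nnegrE ?subr_ge0// ltW.
    by rewrite ler_wpDl// ler_powR// ltW.
  - by move=> t _; rewrite lee_fin gamma_fun_ge0.
  - by apply/measurable_EFinP; exact: measurable_gamma_fun.
  - by move=> t _; rewrite lee_fin gamma_fun_ge0.
  - by apply/measurable_EFinP; exact: measurable_gamma_fun.
move=> y0; have := H (y + 1); rewrite egammaS// lerDr ltW// => /(_ isT).
have := egamma_ge0 y; case: (egamma y) => [r| |]// _; first by rewrite !ltry.
by rewrite gt0_muley// lte_fin.
Qed.

Lemma euler_gammaE y : 0 < y -> egamma y = (euler_gamma y)%:E.
Proof.
move=> y0; rewrite /euler_gamma /Rintegral fineK//.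
by rewrite fin_numElt egamma_lty// (lt_le_trans _ (egamma_ge0 y)) ?ltNyr.
Qed.

Lemma euler_gammaS y : 0 < y -> euler_gamma (y + 1) = y * euler_gamma y.
Proof.
move=> y0; apply: EFin_inj; rewrite EFinM -!euler_gammaE ?addr_gt0//.
exact: egammaS.
Qed.

Lemma euler_gammaS_nat n : euler_gamma n.+1%:R = n`!%:R :> R.
Proof. by apply: EFin_inj; rewrite -euler_gammaE ?ltr0n// egammaS_nat. Qed.

(** Young's inequality for x^y and 1 with the conjugate exponents 1 / y and 1 / (1 - y). *)
Lemma powR_le_chord x y : 0 <= x -> 0 < y < 1 -> x `^ y <= 1 - y + y * x.
Proof.
move=> x0 /andP[y0 y1].
have := @conjugate_powR _ (x `^ y) 1 y^-1 (1 - y)^-1 (powR_ge0 _ _) ler01.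
rewrite !invr_gt0 subr_gt0 !invrK => /(_ y0 y1); rewrite mulr1 powR1 mul1r.
by rewrite -powRrM mulfV ?gt_eqF// powRr1// (mulrC x) (addrC (1 - y)); apply; ring.
Qed.

(* Log-convexity of Gamma between s and s + 1. *)
Lemma euler_gammaD_le s y : 0 < s -> 0 <= y <= 1 ->
  euler_gamma (s + y) <= s `^ y * euler_gamma s.
Proof.
move=> s0 /andP[]; rewrite le_eqVlt => /predU1P[<- _|y0].
  by rewrite addr0 powRr0 mul1r.
rewrite le_eqVlt => /predU1P[->|y1]; first by rewrite euler_gammaS// powRr1// ltW.
have sy0 : 0 < s + y by rewrite addr_gt0.
have s10 : 0 < s + 1 by rewrite addr_gt0.
(* Integrate the chord bound for (t / s)^y against s^y t^(s - 1) e^(-t). Since Gamma (s + 1) = s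
   Gamma s, the right side then adds up to s^y Gamma s. *)
have H : (egamma (s + y) <= (s `^ y * (1 - y))%:E * egamma s +
    (s `^ y * y / s)%:E * egamma (s + 1))%E.
  have c1 : 0 <= s `^ y * (1 - y) by rewrite mulr_ge0 ?powR_ge0// subr_ge0 ltW.
  have c2 : 0 <= s `^ y * y / s by rewrite !mulr_ge0 ?powR_ge0 ?invr_ge0// ltW.
  have mg z (D : set R) : measurable_fun D (fun t => (gamma_fun z t)%:E).
    by apply/measurable_EFinP; exact: measurable_gamma_fun.
  have g0 z t : (0 <= (gamma_fun z t)%:E)%E by rewrite lee_fin gamma_fun_ge0.
  have Z z k : 0 <= k -> (k%:E * egamma z =
      \int[mu]_(t in `]0%R, +oo[) (k%:E * (gamma_fun z t)%:E))%E.
    by move=> k0; apply/esym; apply: ge0_integralZl => //; exact: mg.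
  rewrite !Z// -ge0_integralD//; last 4 first.
  - by move=> t _; rewrite mule_ge0.
  - by apply: measurable_funeM; exact: mg.
  - by move=> t _; rewrite mule_ge0.
  - by apply: measurable_funeM; exact: mg.
  apply: ge0_le_integral => //=; first exact: mg.
    by apply: emeasurable_funD; apply: measurable_funeM; exact: mg.
  move=> t; rewrite /= in_itv/= andbT => t0; rewrite -!EFinM -EFinD lee_fin.
  rewrite /gamma_fun addrK.
  have -> : s + y - 1 = y + (s - 1) by ring.
  have tE : t `^ s = t * t `^ (s - 1).
    by rewrite -{2}(powRr1 (ltW t0)) -powRD_gt0//; congr (_ `^ _); ring.
  have -> : t `^ (y + (s - 1)) = s `^ y * (t / s) `^ y * t `^ (s - 1).
    rewrite powRD_gt0//; congr (_ * _); rewrite -powRM ?mulr_ge0 ?invr_ge0 ?ltW//.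
    by rewrite mulrCA mulfV ?mulr1// gt_eqF.
  have c := @powR_le_chord (t / s) y.
  have {c} : (t / s) `^ y <= 1 - y + y * (t / s).
    by apply: c; rewrite ?y0 ?y1// divr_ge0// ltW.
  move=> /(ler_wpM2l (powR_ge0 s y)) /(ler_wpM2r (powR_ge0 t (s - 1))).
  move=> /(ler_wpM2r (expR_ge0 (- t))) /le_trans; apply.
  by rewrite tE le_eqVlt; apply/orP; left; apply/eqP; field; rewrite gt_eqF.
move: H; rewrite !euler_gammaE// -!EFinM -EFinD lee_fin euler_gammaS//.
move=> /le_trans; apply; rewrite le_eqVlt; apply/orP; left; apply/eqP.
by field; rewrite gt_eqF.
Qed.

(** On (0, 1], log-convexity gives 1 = Gamma 1 <= y^(1 - y) Gamma y; the functional equation carries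
    positivity upwards. *)
Lemma euler_gamma_gt0 y : 0 < y -> 0 < euler_gamma y.
Proof.
have H (z : R) : 0 < z <= 1 -> 0 < euler_gamma z.
  move=> /andP[z0 z1]; have := @euler_gammaD_le z (1 - z) z0.
  rewrite subr_ge0 z1 lerBlDr lerDl ltW// addrC subrK => /(_ isT).
  rewrite (euler_gammaS_nat 0) => /(lt_le_trans ltr01).
  by rewrite pmulr_rgt0// powR_gt0.
move=> y0; have [n yn] : exists n : nat, y <= n.+1%:R.
  by exists (Num.truncn y); rewrite ltW// truncnS_gt.
elim: n y y0 yn => [|n IH] y y0 yn; first by rewrite H ?y0.
have [y1|y1] := leP y 1; first by rewrite H ?y0.
rewrite -(subrK 1 y) euler_gammaS ?subr_gt0// mulr_gt0 ?subr_gt0//.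
by rewrite IH ?subr_gt0// lerBlDr natr1.
Qed.

Lemma euler_gamma_rising y N : 0 < y ->
  euler_gamma (y + N%:R) = euler_gamma y * (rising_coef y N * N`!%:R).
Proof.
move=> y0; elim: N => [|N IH]; first by rewrite addr0 rising_coef0 mul1r mulr1.
rewrite -natr1 addrA euler_gammaS ?ltr_pwDl// IH.
rewrite rising_coefS factS natrM.
have : N.+1%:R != 0 :> R by rewrite pnatr_eq0.
by move=> ?; field; rewrite nat1r.
Qed.

(* Gauss's form of the Gamma function: the limit is 1 / Gamma y for every real y. *)
Definition gauss_seq y N : R := N%:R `^ (1 - y) * rising_coef y N.

(** Log-convexity from N + 1 to N + 1 + y gives the upper bound, from N + 1 + y to N + 2 the lower
    one. They differ by the factor (1 + y / (N + 1))^(y - 1). *)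
Lemma gauss_seq_cvg01 y : 0 < y <= 1 ->
  gauss_seq y @ \oo --> (euler_gamma y)^-1.
Proof.
move=> /andP[y0 y1]; have G0 := euler_gamma_gt0 y0.
rewrite -cvg_shiftS.
have D0 : euler_gamma y != 0 by rewrite gt_eqF.
have ub N : gauss_seq y N.+1 <= (euler_gamma y)^-1.
  have N0 : 0 < N.+1%:R :> R by rewrite ltr0n.
  have := @euler_gammaD_le N.+1%:R y N0; rewrite (ltW y0) y1 => /(_ isT).
  rewrite addrC euler_gamma_rising// euler_gammaS_nat factS natrM !mulrA.
  rewrite ler_pM2r ?ltr0n ?fact_gt0// => /(ler_wpM2l (powR_ge0 N.+1%:R (- y))).
  rewrite -powRD_gt0// addNr powRr0 => H.
  rewrite -[leRHS]mul1r ler_pdivlMr// (le_trans _ H)// /gauss_seq.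
  rewrite addrC powRD_gt0// powRr1; last exact: ltW.
  by rewrite le_eqVlt; apply/orP; left; apply/eqP; ring.
have lb N : (1 + y * harmonic N)^-1 `^ (1 - y) / euler_gamma y <= gauss_seq y N.+1.
  have N0 : 0 < N.+1%:R :> R by rewrite ltr0n.
  have Ny : 0 < N.+1%:R + y by rewrite addr_gt0.
  have := @euler_gammaD_le (N.+1%:R + y) (1 - y) Ny.
  rewrite subr_ge0 y1 lerBlDr lerDl ltW// => /(_ isT).
  have -> : N.+1%:R + y + (1 - y) = N.+2%:R by rewrite -[in RHS]natr1; ring.
  rewrite euler_gammaS_nat.
  rewrite (addrC _ y) euler_gamma_rising// !mulrA ler_pMl ?ltr0n ?fact_gt0//.
  move=> H; rewrite ler_pdivrMr// /gauss_seq.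
  have -> : (1 + y * harmonic N)^-1 = N.+1%:R * (y + N.+1%:R)^-1.
    by apply: invr_inj; rewrite invrK invf_div mulrDl divff ?gt_eqF// addrC.
  have iNy : 0 <= (y + N.+1%:R)^-1 by rewrite invr_ge0 addrC ltW.
  rewrite powRM//.
  rewrite -!mulrA ler_wpM2l ?powR_ge0//.
  move: H => /(ler_wpM2l (powR_ge0 (y + N.+1%:R)^-1 (1 - y))).
  rewrite mulr1 !mulrA -powRM//; last by rewrite addrC ltW.
  by rewrite mulVf ?powR1 ?mul1r 1?mulrC// addrC gt_eqF.
apply: (@squeeze_cvgr _ _ _ _
  (fun N => (1 + y * harmonic N)^-1 `^ (1 - y) / euler_gamma y)
  (cst (euler_gamma y)^-1)).
- by near=> N; rewrite lb ub.
- rewrite -[X in _ --> X]mul1r -[X in X / _](powR_one (1 - y)).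
  apply: cvgMl; apply: cvg_powR => //; rewrite -[X in _ --> X]invr1.
  apply: cvgV => //; rewrite -[X in _ --> X]addr0; apply: cvgD; first exact: cvg_cst.
  by rewrite -[X in _ --> X](mulr0 y); apply: cvgMr; exact: cvg_harmonic.
- exact: cvg_cst.
Unshelve. all: by end_near. Qed.

Lemma cvg_natrD_ratio y : (fun N => (N.+1%:R + y) / N.+1%:R : R) @ \oo --> (1 : R).
Proof.
rewrite (_ : (fun N => _) = (fun N => 1 + y * harmonic N)); last first.
  by apply/funext => N; rewrite mulrDl divff ?pnatr_eq0.
rewrite -[X in _ --> X]addr0; apply: cvgD; first exact: cvg_cst.
by rewrite -[X in _ --> X](mulr0 y); apply: cvgMr; exact: cvg_harmonic.
Qed.

Lemma gauss_seq_shift y N :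
  y * gauss_seq (y + 1) N.+1 = gauss_seq y N.+1 * ((N.+1%:R + y) / N.+1%:R).
Proof.
rewrite /gauss_seq; have N0 : 0 < N.+1%:R :> R by rewrite ltr0n.
have -> : 1 - (y + 1) = - y by ring.
rewrite mulrCA -rising_coef_shift rising_coefS powRD_gt0// powRr1 ?ltW//.
have N2 : N.+2%:R != 0 :> R by rewrite pnatr_eq0.
rewrite [N.+2%:R * _]mulrC divfK//.
have := lt0r_neq0 N0; move: (N.+1%:R) => M M0; by field.
Qed.

(** Moves the limit one unit to the left. At y = 0 the new limit is 0, so the poles of Gamma are
    covered without exception. *)
Lemma gauss_seq_down y (l : R) :
  gauss_seq (y + 1) @ \oo --> l -> gauss_seq y @ \oo --> y * l.
Proof.
move=> c; have {}c : (fun N => gauss_seq (y + 1) N.+1) @ \oo --> l.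
  by rewrite (cvg_shiftS (gauss_seq (y + 1))).
suff : (fun N => gauss_seq y N.+1) @ \oo --> y * l.
  by rewrite (cvg_shiftS (gauss_seq y)).
have H : (fun N => y * gauss_seq (y + 1) N.+1 / ((N.+1%:R + y) / N.+1%:R))
    @ \oo --> y * l / 1.
  apply: cvgM; first exact: cvgMr.
  by apply: cvgV => //; exact: cvg_natrD_ratio.
rewrite -[y * l]divr1.
apply: cvg_trans H; apply: near_eq_cvg; near=> N; rewrite gauss_seq_shift mulfK//.
rewrite mulf_neq0// ?invr_eq0 ?pnatr_eq0// gt_eqF// -ltrBlDr sub0r.
rewrite (lt_le_trans (truncnS_gt (- y)))// ler_nat ltnS.
by near: N; exact: nbhs_infty_ge.
Unshelve. all: by end_near. Qed.

Lemma gauss_seq_up y (l : R) : y != 0 ->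
  gauss_seq y @ \oo --> y * l -> gauss_seq (y + 1) @ \oo --> l.
Proof.
move=> y0 c; have {}c : (fun N => gauss_seq y N.+1) @ \oo --> y * l.
  by rewrite (cvg_shiftS (gauss_seq y)).
suff : (fun N => gauss_seq (y + 1) N.+1) @ \oo --> l.
  by rewrite (cvg_shiftS (gauss_seq (y + 1))).
rewrite (_ : (fun N => _) =
    (fun N => y^-1 * (gauss_seq y N.+1 * ((N.+1%:R + y) / N.+1%:R)))).
  rewrite -[l](mulKf y0); apply: cvgMr; rewrite -[y * l]mulr1.
  by apply: cvgM => //; exact: cvg_natrD_ratio.
by apply/funext => N; rewrite -gauss_seq_shift mulKf.
Qed.

Lemma gauss_seq_cvg_gt0 y : 0 < y -> gauss_seq y @ \oo --> (euler_gamma y)^-1.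
Proof.
move=> y0; have [n yn] : exists n : nat, y <= n.+1%:R.
  by exists (Num.truncn y); rewrite ltW// truncnS_gt.
elim: n y y0 yn => [|n IH] y y0 yn; first by apply: gauss_seq_cvg01; rewrite y0.
have [y1|y1] := leP y 1; first by apply: gauss_seq_cvg01; rewrite y0.
have y10 : 0 < y - 1 by rewrite subr_gt0.
rewrite -(subrK 1 y) euler_gammaS//; apply: gauss_seq_up; first by rewrite gt_eqF.
rewrite invfM mulrA divff ?gt_eqF// mul1r; apply: IH => //.
by rewrite lerBlDr natr1.
Qed.

Lemma gauss_seq_cvg y : gauss_seq y @ \oo --> rgamma y.
Proof.
have H (s : nat) : 0 < y + s%:R ->
    gauss_seq y @ \oo --> (\prod_(k < s) (y + k%:R)) / euler_gamma (y + s%:R).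
  elim: s y => [|s IH] z.
    by rewrite addr0 big_ord0 mul1r => z0; exact: gauss_seq_cvg_gt0.
  move=> zs; rewrite big_ord_recl addr0 -mulrA; apply: gauss_seq_down.
  have -> : z + s.+1%:R = z + 1 + s%:R by rewrite -nat1r addrA.
  have /IH : 0 < z + 1 + s%:R by rewrite -addrA nat1r.
  have -> // : \prod_(k < s) (z + 1 + k%:R) = \prod_(i < s) (z + (lift ord0 i)%:R).
  by apply: eq_bigr => k _; rewrite lift0 -nat1r addrA.
have ys : 0 < y + (gamma_shift y)%:R.
  rewrite /gamma_shift; case: ifPn => [|_]; first by rewrite addr0.
  by rewrite -ltrBlDl sub0r truncnS_gt.
have := H _ ys; rewrite /rgamma; case: ifPn => [/andP[yint y0]|_]; last first.
  by rewrite /gamma invf_div.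
(* At a pole y = - m the factor k = m vanishes, in agreement with the value that [rgamma] has
   there. *)
rewrite (_ : \prod_(k < _) _ = 0) ?mul0r//.
have [m ym] : exists m : nat, y = - m%:R.
  have /natrP[m mE] : - y \is a Num.nat by rewrite natrEint oppr_ge0 y0 rpredN yint.
  by exists m; rewrite -mE opprK.
have ms : (m < gamma_shift y)%N.
  by rewrite /gamma_shift ltNge y0/= ym opprK natrK.
apply/eqP; rewrite prodf_seq_eq0; apply/hasP; exists (Ordinal ms).
  by rewrite mem_index_enum.
by rewrite /= ym addNr.
Qed.

End gamma.

(** * Newton's binomial series *)

Section newton.
Context {R : realType}.
Implicit Types (b q r x : R) (n N : nat).

Lemma ratio_test (u : R^nat) q : 0 < q < 1 ->
  (\forall n \near \oo, `|u n.+1| <= q * `|u n|) -> cvgn (series u).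
Proof.
move=> /andP[q0 q1] [n _ un]; apply: normed_cvg.
pose C := \sum_(i < n.+1) `|u i| / q ^+ i.
have t0 i : 0 <= `|u i| / q ^+ i by rewrite divr_ge0// exprn_ge0// ltW.
have C0 : 0 <= C by apply: sumr_ge0.
have low i : (i <= n)%N -> `|u i| / q ^+ i <= C.
  move=> ni; rewrite /C (bigD1 (Ordinal (ni : (i < n.+1)%N)))//= lerDl.
  exact: sumr_ge0.
have qi i : 0 < q ^+ i by rewrite exprn_gt0.
apply: (@series_le_cvg _ _ (geometric C q)) => [| |i|].
- by move=> i; rewrite normr_ge0.
- by move=> i; rewrite mulr_ge0// ltW.
- rewrite /geometric/= -ler_pdivrMr//.
  have [/low//|/ltnW] := leqP i n.
  elim: i => [|i IH]; first by rewrite leqn0 => /eqP n0; apply: low; rewrite n0.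
  rewrite leq_eqVlt => /predU1P[/esym ->|]; first exact: low.
  rewrite ltnS => ni; apply: le_trans (IH ni).
  rewrite ler_pdivrMr// exprS mulrCA divfK ?gt_eqF//.
  exact: un.
- by apply: is_cvg_geometric_series; rewrite ger0_norm// ltW.
Qed.

Lemma is_cvg_rising_pseries b r : `|r| < 1 -> cvgn (pseries (rising_coef b) r).
Proof.
move=> r1; pose q := (1 + `|r|) / 2.
have rq : `|r| < q by rewrite /q; lra.
have q01 : 0 < q < 1 by rewrite /q; have := normr_ge0 r; lra.
apply: (@ratio_test _ q) => //; near=> n.
rewrite /= rising_coefS exprS !normrM normfV normr_nat.
have n0 : 0 < n.+1%:R :> R by rewrite ltr0n.
suff H : `|b + n%:R| / n.+1%:R * `|r| <= q.
  have -> : `|rising_coef b n| * `|b + n%:R| / n.+1%:R * (`|r| * `|r ^+ n|) =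
    `|b + n%:R| / n.+1%:R * `|r| * (`|rising_coef b n| * `|r ^+ n|) by ring.
  by rewrite ler_wpM2r// mulr_ge0.
rewrite mulrAC ler_pdivrMr//.
apply: (@le_trans _ _ ((`|b| + n%:R) * `|r|)).
  by rewrite ler_wpM2r// (le_trans (ler_normD _ _))// normr_nat.
rewrite mulrDl -natr1 mulrDr mulr1 addrC ler_wpDr//; first by case/andP: q01 => /ltW.
rewrite addrC -lerBrDr (mulrC n%:R) -mulrBl -ler_pdivrMl ?subr_gt0//.
rewrite (le_trans (ltW (truncnS_gt _)))// ler_nat.
by near: n; exact: nbhs_infty_ge.
Unshelve. all: by end_near. Qed.

Definition rising_pseries b r : R := limn (pseries (rising_coef b) r).

Lemma rising_pseries_pascal b r : `|r| < 1 ->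
  rising_pseries b r = (1 - r) * rising_pseries (b + 1) r.
Proof.
move=> r1; pose S c := pseries (rising_coef c) r.
have cS c : S c @ \oo --> rising_pseries c r by exact: is_cvg_rising_pseries.
have SE n : S b n.+1 = S (b + 1) n.+1 - r * S (b + 1) n.
  rewrite /S /pseries/=; elim: n => [|n IH].
    by rewrite !seriesSr !seriesEnat/= !big_geq// mulr0 subr0 !rising_coef0.
  rewrite seriesSr IH [in RHS]seriesSr [series _ n.+1 in X in _ = _ - X]seriesSr.
  by rewrite rising_coef_pascal exprS; ring.
have c1 : (fun n => S b n.+1) @ \oo --> rising_pseries b r by rewrite (cvg_shiftS (S b)).
have c2 : (fun n => S b n.+1) @ \oo --> (1 - r) * rising_pseries (b + 1) r.
  rewrite (funext SE) mulrBl mul1r; apply: cvgB; last by apply: cvgMr; exact: cS.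
  by rewrite (cvg_shiftS (S (b + 1))); exact: cS.
exact: (cvg_unique _ c1 c2).
Qed.

Lemma is_derive_rising_pseries b r : `|r| < 1 ->
  is_derive r 1 (rising_pseries b) (b * rising_pseries (b + 1) r).
Proof.
move=> r1; pose K := (1 + `|r|) / 2.
have K0 : 0 <= K by rewrite /K; have := normr_ge0 r; lra.
have K1 : `|K| < 1 by rewrite ger0_norm// /K; lra.
have rK : `|r| < `|K| by rewrite (ger0_norm K0) /K; lra.
have dE c : pseries_diffs (rising_coef c) = c *: rising_coef (c + 1).
  by apply/funext => i; rewrite /pseries_diffs rising_coef_shift.
have pE (k : R) (f : R^nat) (z : R) :
    pseries (k *: f) z = series (k *: (fun i => f i * z ^+ i)).
  by rewrite /pseries; congr series; apply/funext => i /=; rewrite -scalerAl.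
have cK c : cvgn (pseries (rising_coef c) K) by exact: is_cvg_rising_pseries.
have cZ k c : cvgn (pseries (k *: rising_coef c) K).
  by rewrite pE; apply: is_cvg_seriesZ; exact: cK.
have lZ k c : limn (pseries (k *: rising_coef c) r) = k * rising_pseries c r.
  by rewrite pE lim_seriesZ//; exact: is_cvg_rising_pseries.
have := @pseries_snd_diffs R (rising_coef b) K r (cK b).
rewrite dE.
have -> : pseries_diffs (b *: rising_coef (b + 1)) =
    (b * (b + 1)) *: rising_coef (b + 1 + 1).
  apply/funext => i; transitivity (i.+1%:R * (b * rising_coef (b + 1) i.+1)) => //.
  by rewrite mulrCA rising_coef_shift mulrA.
by move=> /(_ (cZ _ _) (cZ _ _) rK); rewrite lZ.
Qed.

Lemma derive0_cst (f : R -> R) r : 0 <= r ->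
  (forall x, x \in `[0, r] -> is_derive x 1 f 0) -> f r = f 0.
Proof.
move=> r0 df; apply/eqP; rewrite -subr_eq0; apply/eqP.
have H1 : forall x, x \in `]0, r[%R -> is_derive x 1 f ((fun=> 0 : R) x).
  by move=> x xr; apply: df; exact: subset_itv_oo_cc xr.
have H2 : {within `[0, r], continuous f}.
  by apply: derivable_within_continuous => x /df ?; exact: ex_derive.
have H := MVT_segment r0 H1 H2.
by case: H => c _ ->; rewrite mul0r.
Qed.

(** Let S_b be the sum of the series. From S_b' = b S_(b+1) and S_b = (1 - r) S_(b+1), the product
    S_b (1 - r)^b has derivative 0. *)
Lemma rising_pseriesE b r : 0 <= r < 1 -> rising_pseries b r = (1 - r) `^ (- b).
Proof.
move=> /andP[r0 r1].
pose f x := rising_pseries b x * (1 - x) `^ b.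
have df x : x \in `[0, r] -> is_derive x 1 f 0.
  rewrite in_itv/= => /andP[x0 xr].
  have x1 : `|x| < 1 by rewrite ger0_norm// (le_lt_trans xr).
  have x10 : 0 < 1 - x by rewrite subr_gt0 (le_lt_trans xr).
  have d1 := is_derive_rising_pseries b x1.
  have d2 : is_derive x 1 (fun x => (1 - x) `^ b) (- (b * (1 - x) `^ (b - 1))).
    have d3 : is_derive (1 - x) 1 (@powR R ^~ b) (b * (1 - x) `^ (b - 1)).
      exact: is_derive1_powR.
    have d4 : is_derive x 1 (fun x : R => 1 - x) (- 1).
      by rewrite -[- 1 :> R]sub0r; apply: is_deriveB.
    rewrite -[- (b * _)]mulrN1.
    exact: (@is_derive1_comp _ (@powR R ^~ b) (fun x => 1 - x) x _ _ d3 d4).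
  apply: (is_derive_eq (is_deriveM d1 d2)).
  transitivity (rising_pseries b x * - (b * (1 - x) `^ (b - 1)) +
    (1 - x) `^ b * (b * rising_pseries (b + 1) x)) => //.
  rewrite (rising_pseries_pascal _ x1).
  have -> : (1 - x) `^ b = (1 - x) * (1 - x) `^ (b - 1).
    rewrite -[X in _ = X * _](powRr1 (ltW x10)) -powRD_gt0//.
    by congr (_ `^ _); ring.
  by ring.
have := derive0_cst r0 df.
rewrite /f subr0 powR_one mulr1 => H.
have r10 : 0 < 1 - r by rewrite subr_gt0.
rewrite powRN -[LHS](mulfK (lt0r_neq0 (powR_gt0 b r10))) H.
have -> : rising_pseries b 0 = 1.
  apply/cvg_lim => //; rewrite -cvg_shiftS; apply: cvg_near_cst.
  apply: nearW => n; rewrite /pseries/= seriesEord/= big_ord_recl expr0 mulr1.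
  by rewrite rising_coef0 big1 ?addr0// => i _; rewrite lift0 expr0n mulr0.
by rewrite mul1r.
Qed.

End newton.

(** * Continuity of everywhere convergent power series *)

Section entire_pseries.
Context {R : realType}.
Implicit Types (f : R^nat) (z : R).

Lemma is_cvg_entire_pseries_diffs f : (forall z, cvgn (pseries f z)) ->
  forall z, cvgn (pseries (pseries_diffs f) z).
Proof.
(* The factor n + 1 produced by differentiation is at most 2^(n + 1), which doubling the radius
   absorbs. *)
move=> cf z; pose Z := 2 * (`|z| + 1).
have Z0 : 0 <= Z by rewrite mulr_ge0// addr_ge0.
have c : cvgn (pseries (fun i => `|f i|) Z).
  apply: (is_cvg_pseries_inside_norm (cf (Z + 1))).
  by rewrite !ger0_norm ?addr_ge0// ltrDl.
apply: normed_cvg.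
have {}c : cvgn (series (fun i => `|f i.+1| * Z ^+ i.+1)).
  have -> : series (fun i => `|f i.+1| * Z ^+ i.+1) =
      (fun n => pseries (fun i => `|f i|) Z n.+1 - `|f 0|).
    apply/funext => n; rewrite /pseries !seriesEnat/= big_nat_recl//= expr0 mulr1.
    by rewrite addrC addKr.
  apply: is_cvgB; last exact: is_cvg_cst.
  by case/cvg_ex : c => l c; apply/cvg_ex; exists l; rewrite (cvg_shiftS (pseries _ Z)).
apply: (series_le_cvg _ _ _ c).
- by move=> n; rewrite normr_ge0.
- by move=> n; rewrite mulr_ge0// exprn_ge0.
- move=> n /=; rewrite /pseries_diffs !normrM normr_nat normrX mulrAC mulrC.
  rewrite ler_wpM2l// /Z exprMn; apply: ler_pM; rewrite ?exprn_ge0//.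
    by rewrite -natrX ler_nat ltnW// ltn_expl.
  apply: (@le_trans _ _ ((`|z| + 1) ^+ n)).
    by rewrite lerXn2r ?nnegrE ?addr_ge0// lerDl.
  by apply: ler_weXn2l => //; rewrite lerDr.
Qed.

Lemma continuous_entire_pseries f : (forall z, cvgn (pseries f z)) ->
  continuous (fun z => limn (pseries f z)).
Proof.
move=> cf z.
have c1 := is_cvg_entire_pseries_diffs cf.
have c2 := is_cvg_entire_pseries_diffs c1.
have zK : `|z| < `| (`|z| + 1) | by rewrite (ger0_norm (addr_ge0 _ _))// ltrDl.
have d := pseries_snd_diffs (cf _) (c1 _) (c2 _) zK.
apply: differentiable_continuous; apply/derivable1_diffP.
by case: d.
Qed.

End entire_pseries.

(** * The Wright function as a scaling limit *)

Section wright.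
Context {R : realType}.
Variables (a mu : R).
Hypotheses (a01 : 0 < a < 1) (mu01 : 0 < mu < 1).
Implicit Types (x z v D : R) (j m n N : nat).

Lemma gauss_seq_le j N : `|gauss_seq (mu - a * j%:R) N| <= wright_bound a j.
Proof.
rewrite /gauss_seq normrM (ger0_norm (powR_ge0 _ _)) mulrC.
have -> : 1 - (mu - a * j%:R) = a * j%:R + 1 - mu by ring.
exact: rising_coef_wright_bound.
Qed.

(** The bound on [gauss_seq] is uniform in N, so it passes to Gauss's limit; it controls 1 / Gamma
    as the argument runs to - oo. *)
Lemma rgamma_le j : `|rgamma (mu - a * j%:R)| <= wright_bound a j.
Proof.
have c : `|gauss_seq (mu - a * j%:R) n| @[n --> \oo] --> `|rgamma (mu - a * j%:R)|.
  by apply: cvg_norm; exact: gauss_seq_cvg.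
rewrite -(cvg_lim _ c)//; apply: limr_le; first by apply/cvg_ex; eexists; exact: c.
by apply: nearW => n; exact: gauss_seq_le.
Qed.

Definition wright_coef j : R := rgamma (mu - a * j%:R) / j`!%:R.

Lemma wrightE z : wright (- a) mu z = limn (pseries wright_coef z).
Proof.
rewrite /wright /pseries; congr (limn (series _)); apply/funext => n.
by rewrite /wright_coef/= mulNr (addrC _ mu); ring.
Qed.

Lemma is_cvg_wright z : cvgn (pseries wright_coef z).
Proof.
apply: normed_cvg.
apply: (series_le_cvg _ _ _ (is_cvg_wright_bound a01 (normr_ge0 z))).
- by move=> n; rewrite normr_ge0.
- by move=> n; rewrite !mulr_ge0 ?wright_bound_ge0 ?exprn_ge0.
- move=> n /=; rewrite /wright_coef !normrM normrX normfV normr_nat mulrAC.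
  by rewrite ler_wpM2r// ler_wpM2r ?exprn_ge0// rgamma_le.
Qed.

Lemma continuous_wright : continuous (wright (- a) mu).
Proof.
rewrite (funext wrightE); apply: continuous_entire_pseries.
exact: is_cvg_wright.
Qed.

End wright.

Section nat_limits.
Context {R : realType}.
Implicit Types (x v : R) (j m n N : nat).

Lemma cvg_natrV : (fun m => m%:R^-1 : R) @ \oo --> (0 : R).
Proof. by rewrite -cvg_shiftS; exact: cvg_harmonic. Qed.

Lemma bin_fact_le m j : 'C(m, j)%:R / m%:R ^+ j <= j`!%:R^-1 :> R.
Proof.
have [->|m0] := posnP m.
  case: j => [|j]; first by rewrite bin0 expr0 fact0 divr1 invr1.
  by rewrite bin0n mul0r invr_ge0.
have f0 : 0 < j`!%:R :> R by rewrite ltr0n fact_gt0.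
rewrite ler_pdivrMr ?exprn_gt0 ?ltr0n// mulrC ler_pdivlMr//.
rewrite -natrM bin_ffact -natrX ler_nat; elim: j {f0} => // j IH.
by rewrite ffactnSr expnSr leq_mul// leq_subr.
Qed.

Lemma cvg_bin_fact j : (fun m => 'C(m, j)%:R / m%:R ^+ j : R) @ \oo --> (j`!%:R^-1 : R).
Proof.
elim: j => [|j IH].
  under eq_fun do rewrite bin0 expr0 divr1.
  by rewrite fact0 invr1; exact: cvg_cst.
have H : (fun m => 'C(m, j)%:R / m%:R ^+ j * (1 - j%:R * m%:R^-1) / j.+1%:R : R)
    @ \oo --> (j`!%:R^-1 * (1 - j%:R * 0) / j.+1%:R : R).
  apply: cvgMl; apply: cvgM => //; apply: cvgB; first exact: cvg_cst.
  by apply: cvgMr; exact: cvg_natrV.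
rewrite mulr0 subr0 mulr1 -invfM mulrC -natrM -factS in H.
apply: cvg_trans H; apply: near_eq_cvg; near=> m.
have jm : (j < m)%N by near: m; exact: nbhs_infty_gt.
have m0 : m%:R != 0 :> R by rewrite pnatr_eq0 -lt0n (leq_trans _ jm).
have -> : 'C(m, j.+1)%:R = 'C(m, j)%:R * (m%:R - j%:R) / j.+1%:R :> R.
  rewrite -natrB ?(ltnW jm)// -natrM mulnC -mul_bin_left natrM mulrAC divff ?mul1r//.
have j0 : j.+1%:R != 0 :> R by rewrite pnatr_eq0.
rewrite exprS invfM; have mj0 : m%:R ^+ j != 0 :> R by rewrite expf_neq0.
have -> : 1 - j%:R * m%:R^-1 = (m%:R - j%:R) / m%:R :> R by rewrite mulrBl divff.
by ring.
Unshelve. all: by end_near. Qed.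

Lemma cvg_truncn_ratio v : 0 <= v ->
  (fun m => (Num.truncn (v * m%:R))%:R / m%:R : R) @ \oo --> v.
Proof.
move=> v0; apply: (@squeeze_cvgr _ _ _ _ (fun m => v - m%:R^-1) (cst v)).
- near=> m; have m0 : 0 < m%:R :> R by rewrite ltr0n; near: m; exact: nbhs_infty_gt.
  have /andP[H1 H2] := truncn_itv (mulr_ge0 v0 (ltW m0)).
  rewrite ler_pdivrMr// H1 andbT ler_pdivlMr// mulrBl mulVf ?gt_eqF//.
  by rewrite lerBlDr natr1 ltW.
- by rewrite -[X in _ --> X]subr0; apply: cvgB; [exact: cvg_cst|exact: cvg_natrV].
- exact: cvg_cst.
Unshelve. all: by end_near. Qed.

Lemma cvg_truncn_pinfty v : 0 < v ->
  (fun m => Num.truncn (v * m%:R)) @ \oo --> \oo.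
Proof.
move=> v0; apply/cvgnyPge => N; near=> m.
rewrite truncn_ge_nat ?mulr_ge0 ?(ltW v0)// -ler_pdivrMl//.
rewrite (le_trans (ltW (truncnS_gt _)))// ler_nat.
by near: m; exact: nbhs_infty_ge.
Unshelve. all: by end_near. Qed.

(* (1 - t)^N lies between exp (- N t / (1 - t)) and exp (- N t). *)
Lemma cvg_exprn_expR x v : 0 <= x -> 0 <= v ->
  (fun m => (1 - x / m%:R) ^+ Num.truncn (v * m%:R)) @ \oo --> expR (- (x * v)).
Proof.
move=> x0 v0; pose r m : R := (Num.truncn (v * m%:R))%:R / m%:R.
have rv : r @ \oo --> v by exact: cvg_truncn_ratio.
have xm0 : (fun m => x / m%:R) @ \oo --> (0 : R).
  by rewrite -(mulr0 x); apply: cvgMr; exact: cvg_natrV.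
have cexp (u : R^nat) l : u @ \oo --> l -> (fun m => expR (- u m)) @ \oo --> expR (- l).
  by move=> ul; apply: (cvg_comp (fun m => - u m) expR (cvgN ul)); exact: continuous_expR.
apply: (@squeeze_cvgr _ _ _ _ (fun m => expR (- (x * r m / (1 - x / m%:R))))
  (fun m => expR (- (x * r m)))).
- near=> m; have m0 : 0 < m%:R :> R by rewrite ltr0n; near: m; exact: nbhs_infty_gt.
  have xm : x < m%:R.
    rewrite (lt_le_trans (truncnS_gt x))// ler_nat; near: m; exact: nbhs_infty_ge.
  have t0 : 0 <= x / m%:R by rewrite divr_ge0// ltW.
  have t1 : 0 < 1 - x / m%:R by rewrite subr_gt0 ltr_pdivrMr// mul1r.
  set N := Num.truncn _; apply/andP; split.
    have -> : - (x * r m / (1 - x / m%:R)) = N%:R * - (x / m%:R / (1 - x / m%:R)).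
      by rewrite /r -/N; ring.
    rewrite expRM_natl; apply: lerXn2r; rewrite ?nnegrE ?expR_ge0 ?(ltW t1)//.
    rewrite expRN -[leRHS]invrK lef_pV2 ?posrE ?expR_gt0 ?invr_gt0//.
    apply: le_trans (expR_ge1Dx _).
    move: (x / m%:R) t1 => t t1; rewrite le_eqVlt; apply/orP; left; apply/eqP.
    by field; rewrite gt_eqF.
  have -> : - (x * r m) = N%:R * - (x / m%:R) by rewrite /r -/N; ring.
  rewrite expRM_natl; apply: lerXn2r; rewrite ?nnegrE ?expR_ge0 ?(ltW t1)//.
  exact: expR_ge1Dx.
- apply: cexp; rewrite -[X in _ --> X]divr1.
  apply: cvgM; first exact: cvgMr.
  apply: cvgV => //; rewrite -[X in _ --> X]subr0.
  by apply: cvgB => //; exact: cvg_cst.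
- by apply: cexp; exact: cvgMr.
Unshelve. all: by end_near. Qed.

End nat_limits.

(** * Limit, bounds and sign of the rescaled coefficients *)

Section step_density.
Context {R : realType}.
Variables (a mu x : R).
Hypotheses (a01 : 0 < a < 1) (mu01 : 0 < mu < 1) (x0 : 0 <= x).
Implicit Types (v D : R) (j m n N : nat).

(* With N = floor (v m), its limit for m -> oo is
   v ^ (mu - 1) W_(-a, mu) (- x v ^ (-a)); see step_dens_cvg. *)
Definition step_dens m N : R :=
  m%:R `^ (1 - mu) * subord_coef a mu (x * m%:R `^ (a - 1)) m N.

(** The j-th summand of [step_dens], with the powers of m and N distributed so that every factor has
    a limit of its own when N / m -> v. *)
Definition step_term m j N : R := 'C(m, j)%:R / m%:R ^+ j * (- x) ^+ j *
  (m%:R / N%:R) `^ (1 - mu + a * j%:R) * gauss_seq (mu - a * j%:R) N.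

Lemma step_densE m N : (0 < m)%N -> (0 < N)%N ->
  step_dens m N = \sum_(j < m.+1) step_term m j N.
Proof.
move=> m0 N0; rewrite /step_dens /subord_coef mulr_sumr; apply: eq_bigr => j _.
have {}m0 : 0 < m%:R :> R by rewrite ltr0n.
have {}N0 : 0 < N%:R :> R by rewrite ltr0n.
rewrite /step_term /gauss_seq.
have -> : 1 - (mu - a * j%:R) = 1 - mu + a * j%:R by ring.
set q := 1 - mu + a * j%:R.
have -> : (m%:R / N%:R) `^ q = m%:R `^ q / N%:R `^ q.
  rewrite powRM ?invr_ge0 ?ltW//; congr (_ * _).
  by rewrite -powR_inv1 ?ltW// powRAC powR_inv1 ?powR_ge0.
have -> : (- (x * m%:R `^ (a - 1))) ^+ j = (- x) ^+ j * m%:R `^ (a * j%:R) / m%:R ^+ j.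
  rewrite -mulNr exprMn -mulrA; congr (_ * _).
  rewrite -!powR_mulrn ?powR_ge0 ?ltW// -powRrM -powRN -powRD_gt0//.
  by congr (_ `^ _); ring.
have -> : m%:R `^ q = m%:R `^ (1 - mu) * m%:R `^ (a * j%:R) by exact: powRD_gt0.
have : m%:R ^+ j != 0 :> R by rewrite expf_neq0// gt_eqF.
have : N%:R `^ q != 0 by rewrite gt_eqF// powR_gt0.
by move: (N%:R `^ q) (m%:R ^+ j) => A B A0 B0; field; rewrite A0.
Qed.

(** D bounds m / N, which is about 1 / v. As D >= 1, the power of m / N is at most D^(j + 1), and
    the terms in j remain summable. *)
Lemma step_term_le D m j N : 1 <= D -> (0 < m)%N -> (0 < N)%N ->
  m%:R <= D * N%:R ->
  `|step_term m j N| <= D * (wright_bound a j * (D * x) ^+ j / j`!%:R).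
Proof.
move=> D1 m0 N0 mDN; have D0 : 0 <= D by rewrite (le_trans ler01).
have /andP[a0 a1] := a01; have /andP[mu0 mu1] := mu01.
have aj0 : 0 <= a * j%:R by rewrite mulr_ge0// ltW.
have aj1 : a * j%:R <= j%:R by rewrite ler_piMl// ltW.
have Dj : (m%:R / N%:R) `^ (1 - mu + a * j%:R) <= D * D ^+ j.
  apply: (@le_trans _ _ (D `^ (1 - mu + a * j%:R))).
    apply: ge0_ler_powR; rewrite ?nnegrE ?divr_ge0//; first by lra.
    by rewrite ler_pdivrMr// ltr0n.
  by rewrite -exprS -powR_mulrn// ler_powR// -natr1; lra.
have := gauss_seq_le a01 mu01 j N; rewrite /step_term.
move: (gauss_seq _ _) => g gle.
rewrite !normrM normrX normrN (ger0_norm x0).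
rewrite (ger0_norm (powR_ge0 _ _)) -normrM ger0_norm; last first.
  by rewrite mulr_ge0// invr_ge0 exprn_ge0.
have -> : D * (wright_bound a j * (D * x) ^+ j / j`!%:R) =
    j`!%:R^-1 * x ^+ j * (D * D ^+ j) * wright_bound a j by rewrite exprMn; ring.
apply: ler_pM; rewrite ?normr_ge0//.
  by rewrite !mulr_ge0 ?powR_ge0 ?exprn_ge0// invr_ge0 exprn_ge0.
apply: ler_pM; rewrite ?powR_ge0//.
  by rewrite !mulr_ge0 ?exprn_ge0// invr_ge0 exprn_ge0.
by rewrite ler_wpM2r ?exprn_ge0// bin_fact_le.
Qed.

Definition step_dom D j : R := D * (wright_bound a j * (D * x) ^+ j / j`!%:R).

Lemma is_cvg_step_dom D : 0 <= D -> cvgn (series (step_dom D)).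
Proof.
move=> D0; have Dx : 0 <= D * x by rewrite mulr_ge0.
exact: (is_cvg_seriesZ (is_cvg_wright_bound a01 Dx)).
Qed.

(** From d m >= 2 follows floor (v m) > v m - 1 >= d m / 2. The summand 1 makes the constant at
    least 1, as [step_term_le] requires. *)
Lemma truncn_ratio_le (d v : R) m : 0 < d -> d <= v -> 2 / d <= m%:R ->
  (0 < Num.truncn (v * m%:R))%N /\
  m%:R <= (1 + 2 / d) * (Num.truncn (v * m%:R))%:R.
Proof.
move=> d0 dv dm; have m0 : 0 <= m%:R :> R by [].
have dm2 : 2 <= d * m%:R by rewrite mulrC -ler_pdivrMr.
have vm2 : d * m%:R <= v * m%:R by rewrite ler_wpM2r.
have /andP[_ Nv] := truncn_itv (le_trans (le_trans (ler0n _ 2) dm2) vm2).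
move: Nv; rewrite -natr1; set N := Num.truncn _ => Nv.
split; first by rewrite truncn_gt0; lra.
rewrite mulrDl mul1r ler_wpDl// -(ler_pM2l d0) mulrA.
by rewrite (mulrCA d) mulfV ?gt_eqF//; lra.
Qed.

(** Tannery's theorem: C(m, j) / m^j tends to 1 / j!, m / N to 1 / v and [gauss_seq] to 1 / Gamma,
    so each summand tends to a term of the Wright series. *)
Lemma step_dens_cvg v : 0 < v ->
  (fun m => step_dens m (Num.truncn (v * m%:R))) @ \oo -->
    v `^ (mu - 1) * wright (- a) mu (- x * v `^ (- a)).
Proof.
move=> v0; pose N m := Num.truncn (v * m%:R : R).
have D0 : 0 <= 1 + 2 / v by rewrite addr_ge0// divr_ge0// ltW.
pose l j := j`!%:R^-1 * (- x) ^+ j * v^-1 `^ (1 - mu + a * j%:R) *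
  rgamma (mu - a * j%:R).
have [||cl cs] := @tannery R (fun m j => step_term m j (N m)) _ l (is_cvg_step_dom D0).
- near=> m => j; have [|N0 mN] := @truncn_ratio_le v v m v0 (lexx _).
    rewrite (le_trans (ltW (truncnS_gt _)))// ler_nat.
    by near: m; exact: nbhs_infty_ge.
  apply: step_term_le => //; first by rewrite lerDl divr_ge0// ltW.
  by near: m; exact: nbhs_infty_gt.
- move=> j; apply: cvgM; last first.
    apply: (cvg_comp N _ (cvg_truncn_pinfty v0)); exact: gauss_seq_cvg.
  apply: cvgM; first by apply: cvgMl; exact: cvg_bin_fact.
  apply: cvg_powR; first by rewrite invr_gt0.
  rewrite (_ : (fun m => _) = (fun m => ((N m)%:R / m%:R)^-1)); last first.
    by apply/funext => m; rewrite invf_div.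
  by apply: cvgV; [exact: lt0r_neq0|apply: cvg_truncn_ratio; exact: ltW].
have -> : v `^ (mu - 1) * wright (- a) mu (- x * v `^ (- a)) = limn (series l).
  rewrite wrightE.
  transitivity (limn (series (v `^ (mu - 1) *:
      (fun j => wright_coef a mu j * (- x * v `^ (- a)) ^+ j)))).
    by rewrite lim_seriesZ//; exact: is_cvg_wright.
  congr (limn (series _)); apply/funext => j.
  transitivity (v `^ (mu - 1) * (wright_coef a mu j * (- x * v `^ (- a)) ^+ j)) => //.
  rewrite /l /wright_coef exprMn -(powR_mulrn j (powR_ge0 v _)) -powRrM.
  have -> : v^-1 `^ (1 - mu + a * j%:R) = v `^ (mu - 1) * v `^ (- a * j%:R).
    rewrite -powRD_gt0// -powR_inv1 ?ltW// -powRrM; congr (_ `^ _); ring.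
  by ring.
apply: cvg_trans cs; apply: near_eq_cvg; near=> m; rewrite step_densE//.
- by near: m; exact: nbhs_infty_gt.
- have [|//] := @truncn_ratio_le v v m v0 (lexx _).
  rewrite (le_trans (ltW (truncnS_gt _)))// ler_nat.
  by near: m; exact: nbhs_infty_ge.
Unshelve. all: by end_near. Qed.

(** Uniformity in v >= d is what dominated convergence on [d, +oo) asks for. The constant 1 + 2 / d
    in the dominating series is the reason why d must stay positive. *)
Lemma step_dens_bounded d : 0 < d -> exists B : R,
  \forall m \near \oo, forall v, d <= v ->
    `|step_dens m (Num.truncn (v * m%:R))| <= B.
Proof.
move=> d0; have D1 : 1 <= 1 + 2 / d by rewrite lerDl divr_ge0// ltW.
have D0 := le_trans ler01 D1.
exists (limn (series (step_dom (1 + 2 / d)))); near=> m => v dv.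
have [|N0 mN] := @truncn_ratio_le d v m d0 dv.
  rewrite (le_trans (ltW (truncnS_gt _)))// ler_nat.
  by near: m; exact: nbhs_infty_ge.
have m0 : (0 < m)%N by near: m; exact: nbhs_infty_gt.
rewrite step_densE// (le_trans (ler_norm_sum _ _ _))//.
apply: (@le_trans _ _ (series (step_dom (1 + 2 / d)) m.+1)).
  by rewrite seriesEord/=; apply: ler_sum => j _; exact: step_term_le.
apply: nondecreasing_cvgn_le; last exact: is_cvg_step_dom.
apply/nondecreasing_seqP => n; rewrite seriesSr lerDl /step_dom.
by rewrite !mulr_ge0 ?wright_bound_ge0 ?exprn_ge0// mulr_ge0.
Unshelve. all: by end_near. Qed.

Lemma step_dens_ge0 : \forall m \near \oo, forall N, 0 <= step_dens m N.
Proof.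
have /andP[a0 a1] := a01; have /andP[mu0 mu1] := mu01.
(* The weight w tends to 0 because a < 1, so it lies in [0, 1] for large m and [subord_coef_ge0]
   applies. *)
have c : (fun m => x * m%:R `^ (a - 1)) @ \oo --> (0 : R).
  rewrite -(mulr0 x) -opprB; apply: cvgMr.
  rewrite -(cvg_shiftS (fun m => m%:R `^ (- (1 - a)))).
  by apply: cvg_powR_pinfty; rewrite subr_gt0.
move/cvgrPdist_le : c => /(_ 1 ltr01) c.
near=> m => N; rewrite /step_dens mulr_ge0 ?powR_ge0//.
apply: subord_coef_ge0; [by rewrite !ltW|exact: ltW|].
have w0 : 0 <= x * m%:R `^ (a - 1) by rewrite mulr_ge0 ?powR_ge0.
rewrite w0/= -[leLHS]ger0_norm// -normrN -sub0r.
by near: m.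
Unshelve. all: by end_near. Qed.

Lemma weighted_wright_ge0 v : 0 < v ->
  0 <= v `^ (mu - 1) * wright (- a) mu (- x * v `^ (- a)).
Proof.
move=> v0; have c := step_dens_cvg v0; rewrite -(cvg_lim _ c)//.
apply: limr_ge; first by apply/cvg_ex; eexists; exact: c.
by apply: filterS step_dens_ge0 => m; exact.
Qed.

End step_density.

(** * The Laplace transform *)

Section step_integral.
Context {R : realType}.
Notation mu := (@lebesgue_measure R).
Implicit Types (v : R) (m n N : nat) (u : R^nat).

Definition grid m N : set R := `[N%:R / m%:R, N.+1%:R / m%:R[.

Lemma gridP m N v : (0 < m)%N -> 0 <= v ->
  grid m N v <-> Num.truncn (v * m%:R) = N.
Proof.
move=> m0 v0; have m0' : 0 < m%:R :> R by rewrite ltr0n.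
have vm0 : 0 <= v * m%:R by rewrite mulr_ge0.
rewrite /grid/= in_itv/= ler_pdivrMr// ltr_pdivlMr//; split; first exact: truncn_def.
by move=> <-; exact: truncn_itv.
Qed.

Lemma grid_ge0 m N v : grid m N v -> 0 <= v.
Proof. by rewrite /grid/= in_itv/= => /andP[+ _]; apply: le_trans; rewrite divr_ge0. Qed.

Lemma bigcup_grid m : (0 < m)%N -> \bigcup_N grid m N = `[0%R, +oo[%classic.
Proof.
move=> m0; apply/seteqP; split=> v.
  by move=> [N _ /grid_ge0]; rewrite /= in_itv/= andbT.
rewrite /= in_itv/= andbT => v0; exists (Num.truncn (v * m%:R)) => //.
exact/gridP.
Qed.

Lemma trivIset_grid m : (0 < m)%N -> trivIset setT (grid m).
Proof.
move=> m0; apply/trivIsetP => i j _ _ ij; apply/seteqP; split=> // v [vi vj].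
have v0 := grid_ge0 vi; move/(gridP _ m0 v0) : vi => vi; move/(gridP _ m0 v0) : vj => vj.
by move: ij; rewrite -vi -vj eqxx.
Qed.

Lemma measurable_grid m N : measurable (grid m N).
Proof. exact: measurable_itv. Qed.

Lemma measurable_step u m (D : set R) : (0 < m)%N -> D `<=` `[0%R, +oo[%classic ->
  measurable_fun D (fun v => u (Num.truncn (v * m%:R))).
Proof.
move=> m0 D0; apply: (measurable_funS _ D0); first exact: measurable_itv.
rewrite -(bigcup_grid m0); apply/measurable_fun_bigcup => [N|N]; first exact: measurable_grid.
apply: (eq_measurable_fun (cst (u N))); last exact: measurable_cst.
by move=> v /[!inE] vN; rewrite ((gridP _ m0 (grid_ge0 vN)).1 vN).
Qed.

Lemma integral_step u m : (0 < m)%N -> (forall N, 0 <= u N) ->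
  (\int[mu]_(v in `[0%R, +oo[) (u (Num.truncn (v * m%:R)))%:E =
   m%:R^-1%:E * \sum_(0 <= N <oo) (u N)%:E)%E.
Proof.
move=> m0 u0; rewrite -(bigcup_grid m0) ge0_integral_bigcup//=; last 4 first.
- by move=> N; exact: measurable_grid.
- apply/measurable_EFinP; apply: measurable_step => //.
  by rewrite bigcup_grid.
- by move=> v _; rewrite lee_fin.
- exact: trivIset_grid.
rewrite -nneseriesZl; last by move=> N _; rewrite lee_fin.
apply: eq_eseriesr => N _.
transitivity (\int[mu]_(v in grid m N) (cst (u N)%:E) v)%E.
  apply: eq_integral => v /[!inE] vN.
  by rewrite /cst ((gridP _ m0 (grid_ge0 vN)).1 vN).
rewrite integral_cst; last exact: measurable_grid.
have m0' : 0 < m%:R :> R by rewrite ltr0n.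
transitivity ((u N)%:E * mu (grid m N))%E; first by [].
rewrite /grid lebesgue_measure_itv/= lte_fin ltr_pM2r ?invr_gt0// ltr_nat ltnSn.
rewrite -EFinB -EFinM; congr EFin.
by rewrite -mulrBl -natr1 addrAC subrr add0r mul1r mulrC.
Qed.

End step_integral.

Section generating_function.
Context {R : realType}.
Implicit Types (a b r w : R) (m N : nat).

Lemma subord_coef_series a b w m r : 0 <= r < 1 ->
  series (fun N => subord_coef a b w m N * r ^+ N) @ \oo -->
    (1 - w * (1 - r) `^ a) ^+ m * (1 - r) `^ (- b).
Proof.
move=> r01; have /andP[r0 r1] := r01.
have r10 : 0 < 1 - r by rewrite subr_gt0.
have -> : (1 - w * (1 - r) `^ a) ^+ m * (1 - r) `^ (- b) = \sum_(j < m.+1)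
    'C(m, j)%:R * (- w) ^+ j * rising_pseries (b - a * j%:R) r.
  rewrite exprDn mulr_suml; apply: eq_bigr => j _.
  rewrite expr1n mul1r rising_pseriesE// -mulNr exprMn -mulr_natr.
  have -> : - (b - a * j%:R) = a * j%:R + - b by ring.
  by rewrite powRD_gt0// powRrM powR_mulrn ?powR_ge0//; ring.
have -> : series (fun N => subord_coef a b w m N * r ^+ N) = (fun n => \sum_(j < m.+1)
    'C(m, j)%:R * (- w) ^+ j * pseries (rising_coef (b - a * j%:R)) r n).
  apply/funext => n; rewrite seriesEord/=.
  under [RHS]eq_bigr do rewrite /pseries seriesEord/= mulr_sumr.
  rewrite exchange_big/=; apply: eq_bigr => N _.
  by rewrite /subord_coef mulr_suml; apply: eq_bigr => j _; rewrite mulrA.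
apply: cvg_big => [|j _]; first exact: add_continuous.
by apply: cvgMr; apply: is_cvg_rising_pseries; rewrite ger0_norm.
Qed.

End generating_function.

Section laplace.
Context {R : realType}.
Notation leb := (@lebesgue_measure R).
Variables (a mu x : R).
Hypotheses (a01 : 0 < a < 1) (mu01 : 0 < mu < 1) (x0 : 0 <= x).
Implicit Types (v K d : R) (m n N : nat).

(** The generating function at z = 1 - K / m: there w (1 - z)^a = x K^a / m and (1 - z)^(-mu) = (m /
    K)^mu, and the other powers of m cancel. K = 1 yields the Laplace integral, other K the bound
    near 0. *)
Lemma integral_step_dens K m : 0 < K <= m%:R ->
  (forall N, 0 <= step_dens a mu x m N) ->
  (\int[leb]_(v in `[0%R, +oo[)
     (step_dens a mu x m (Num.truncn (v * m%:R)) *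
      (1 - K / m%:R) ^+ Num.truncn (v * m%:R))%:E =
   ((1 - x * K `^ a / m%:R) ^+ m * K `^ (- mu))%:E)%E.
Proof.
move=> /andP[K0 Km] s0; have m0 : 0 < m%:R :> R by exact: lt_le_trans Km.
have r0 : 0 <= 1 - K / m%:R by rewrite subr_ge0 ler_pdivrMr// mul1r.
have r1 : 1 - K / m%:R < 1 by rewrite ltrBlDr ltrDl divr_gt0.
pose u N := step_dens a mu x m N * (1 - K / m%:R) ^+ N.
rewrite (integral_step (u := u)); last 2 first.
- by rewrite -(ltr0n R).
- by move=> N; rewrite mulr_ge0// exprn_ge0.
have c : series u @ \oo --> m%:R * ((1 - x * K `^ a / m%:R) ^+ m * K `^ (- mu)).
  have -> : series u = (fun n => m%:R `^ (1 - mu) * series (fun N =>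
      subord_coef a mu (x * m%:R `^ (a - 1)) m N * (1 - K / m%:R) ^+ N) n).
    apply/funext => n; rewrite !seriesEord/= mulr_sumr; apply: eq_bigr => N _.
    by rewrite mulrA.
  have -> : m%:R * ((1 - x * K `^ a / m%:R) ^+ m * K `^ (- mu)) =
      m%:R `^ (1 - mu) * ((1 - x * m%:R `^ (a - 1) * (1 - (1 - K / m%:R)) `^ a) ^+ m *
        (1 - (1 - K / m%:R)) `^ (- mu)).
    have -> : 1 - (1 - K / m%:R) = K * m%:R^-1 by ring.
    rewrite !powRM ?invr_ge0 ?ltW//.
    have pV q : m%:R^-1 `^ q = m%:R `^ (- q) :> R.
      by rewrite -powR_inv1 ?ltW// -powRrM mulN1r.
    rewrite !pV opprK.
    have -> : x * m%:R `^ (a - 1) * (K `^ a * m%:R `^ (- a)) = x * K `^ a / m%:R.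
      have -> : m%:R^-1 = m%:R `^ (a - 1) * m%:R `^ (- a) :> R.
        by rewrite -powRD_gt0// -powR_inv1 ?ltW//; congr (_ `^ _); ring.
      by ring.
    have mE : m%:R = m%:R `^ (1 - mu) * m%:R `^ mu :> R.
      by rewrite -powRD_gt0// subrK powRr1// ltW.
    by rewrite [X in X * _ = _]mE; ring.
  apply: cvgMr; apply: subord_coef_series; rewrite r0 r1//.
have -> : (\sum_(0 <= N <oo) (u N)%:E)%E =
    (m%:R * ((1 - x * K `^ a / m%:R) ^+ m * K `^ (- mu)))%:E.
  apply/cvg_lim => //; rewrite (_ : (fun n => _) = EFin \o series u); last first.
    by apply/funext => n /=; rewrite seriesEnat/= sumEFin.
  by apply: cvg_EFin; [exact: nearW|exact: c].
by rewrite -EFinM mulKf// gt_eqF.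
Qed.

Lemma bernoulli_ineq (t : R) N : 0 <= t <= 1 -> 1 - N%:R * t <= (1 - t) ^+ N.
Proof.
move=> /andP[t0 t1]; elim: N => [|N IH]; first by rewrite mul0r subr0 expr0.
rewrite exprS; have t10 : 0 <= 1 - t by rewrite subr_ge0.
apply: le_trans (ler_wpM2l t10 IH); rewrite -natr1.
have : 0 <= t * (N%:R * t) by rewrite !mulr_ge0.
by move: (N%:R : R) => n; lra.
Qed.

Definition laplace_fun v : R :=
  v `^ (mu - 1) * wright (- a) mu (- x * v `^ (- a)) * expR (- v).

Lemma laplace_fun_ge0 v : 0 < v -> 0 <= laplace_fun v.
Proof. by move=> v0; rewrite mulr_ge0 ?expR_ge0// weighted_wright_ge0. Qed.

Lemma measurable_laplace_fun (D : set R) : measurable_fun D laplace_fun.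
Proof.
apply: measurable_funTS; apply: measurable_funM; last first.
  by apply: measurableT_comp => //; exact: measurable_funN.
apply: measurable_funM; first exact: measurable_powR.
apply: measurableT_comp.
  by apply: continuous_measurable_fun; exact: continuous_wright.
by apply: measurable_funM => //; exact: measurable_powR.
Qed.

Definition step_fun m v : R := step_dens a mu x m (Num.truncn (v * m%:R)) *
  (1 - 1 / m%:R) ^+ Num.truncn (v * m%:R).

Lemma measurable_step_fun m (D : set R) : (0 < m)%N -> D `<=` `[0%R, +oo[%classic ->
  measurable_fun D (step_fun m).
Proof.
move=> m0 D0.
exact: (@measurable_step R (fun N => step_dens a mu x m N * (1 - 1 / m%:R) ^+ N)).
Qed.

Lemma step_fun_cvg v : 0 < v -> (fun m => step_fun m v) @ \oo --> laplace_fun v.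
Proof.
move=> v0; apply: cvgM; first exact: step_dens_cvg.
by rewrite -[in X in _ --> X](mul1r v); apply: cvg_exprn_expR => //; exact: ltW.
Qed.

Lemma step_fun_tail_cvg d : 0 < d ->
  (\int[leb]_(v in `[d, +oo[) (step_fun m v)%:E)%E @[m --> \oo] -->
  (\int[leb]_(v in `[d, +oo[) (laplace_fun v)%:E)%E.
Proof.
move=> d0; have [B nB] := step_dens_bounded a01 mu01 x0 d0.
have [n0 _ n0P] : \forall m \near \oo, (0 < m)%N /\
    forall v, d <= v -> `|step_dens a mu x m (Num.truncn (v * m%:R))| <= B.
  near=> m; split; first by near: m; exact: nbhs_infty_gt.
  by near: m.
have B0 : 0 <= B by have [_ /(_ d (lexx _))] := n0P n0 (leqnn _); exact: le_trans.
(* The bound B holds for large m only, whereas domination is required at every index; hence the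
   shift by n0. *)
rewrite -(cvg_shiftn n0).
have dsub : `[d, +oo[%classic `<=` `[0%R, +oo[%classic.
  by apply: subset_itvr; rewrite bnd_simp ltW.
(* For N = floor (v m), (1 - 1 / m)^N <= e^(- N / m) and N / m >= v - 1, hence the dominating
   function B e^(1 - v). *)
have [|||||_ _ h] := @dominated_convergence _ _ R leb (`[d, +oo[%classic) (measurable_itv _)
  (fun n v => (step_fun (n + n0) v)%:E) (fun v => (laplace_fun v)%:E)
  (fun v => ((B * expR 1)%:E * (expR (- v))%:E)%E).
- move=> n; apply/measurable_EFinP; apply: measurable_step_fun => //.
  by have [] := n0P (n + n0)%N (leq_addl _ _).
- by apply/measurable_EFinP; exact: measurable_laplace_fun.
- apply: aeW => v; rewrite /= in_itv/= andbT => dv.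
  apply: cvg_EFin; first exact: nearW.
  rewrite (cvg_shiftn n0 (fun m => step_fun m v)).
  by apply: step_fun_cvg; exact: lt_le_trans dv.
- apply: (@integrableS _ _ _ leb (`]0%R, +oo[%classic)) => //.
    by apply: subset_itvr; rewrite bnd_simp.
  apply: integrableZl => //.
  apply/integrableP; split.
    by apply/measurable_EFinP; apply: measurableT_comp => //; exact: measurable_funN.
  have -> : (\int[leb]_(v in `]0%R, +oo[) `|(expR (- v))%:E| = egamma 1)%E.
    apply: eq_integral => v _; rewrite /gamma_fun subrr powRr0 mul1r abse_EFin.
    by rewrite ger0_norm ?expR_ge0.
  by rewrite egamma1 ltry.
- apply: aeW => v n; rewrite /= in_itv/= andbT => dv.
  have [m0 /(_ v dv) mB] := n0P (n + n0)%N (leq_addl _ _).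
  rewrite -EFinM lee_fin /step_fun normrM -mulrA; apply: ler_pM => //.
  have m0' : 0 < (n + n0)%:R :> R by rewrite ltr0n.
  have m1 : 0 <= 1 - 1 / (n + n0)%:R :> R.
    by rewrite subr_ge0 ler_pdivrMr// mul1r ler1n.
  have v0 : 0 <= v by rewrite (le_trans (ltW d0)).
  have /andP[_ Nv] := truncn_itv (mulr_ge0 v0 (ltW m0')).
  move: Nv; set N := Num.truncn _ => Nv.
  rewrite ger0_norm ?exprn_ge0// -expRD.
  apply: (@le_trans _ _ (expR (- (1 / (n + n0)%:R)) ^+ N)).
    by apply: lerXn2r; rewrite ?nnegrE ?expR_ge0//; exact: expR_ge1Dx.
  have H : v - 1 <= N%:R / (n + n0)%:R.
    rewrite ler_pdivlMr// mulrBl mul1r.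
    have : 1 <= (n + n0)%:R :> R by rewrite ler1n.
    by rewrite -natr1 in Nv; lra.
  by rewrite -expRM_natl ler_expR mulrN mul1r; lra.
exact: h.
Unshelve. all: by end_near. Qed.

(* No bound uniform in m is available near v = 0, but for v < d Bernoulli's
   inequality gives 1 <= 2 (1 - K / m) ^ floor (v m) with K = 1 / (2 d), and the
   integral against this slower exponential is known exactly. *)
Lemma step_fun_head d : 0 < d -> \forall m \near \oo,
  (\int[leb]_(v in `[0%R, d[) (step_fun m v)%:E <= (2 * (2 * d) `^ mu)%:E)%E.
Proof.
move=> d0; pose K := (2 * d)^-1; have K0 : 0 < K by rewrite invr_gt0 mulr_gt0.
near=> m.
have s0 : forall N, 0 <= step_dens a mu x m N by near: m; exact: step_dens_ge0.
have m0 : (0 < m)%N by near: m; exact: nbhs_infty_gt.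
have Km : K <= m%:R.
  rewrite (le_trans (ltW (truncnS_gt _)))// ler_nat; near: m; exact: nbhs_infty_ge.
have xKm : x * K `^ a <= m%:R.
  rewrite (le_trans (ltW (truncnS_gt _)))// ler_nat; near: m; exact: nbhs_infty_ge.
have m0' : 0 < m%:R :> R by rewrite ltr0n.
pose G v : R := step_dens a mu x m (Num.truncn (v * m%:R)) *
  (1 - K / m%:R) ^+ Num.truncn (v * m%:R).
have r0 : 0 <= 1 - K / m%:R by rewrite subr_ge0 ler_pdivrMr// mul1r.
have G0 v : 0 <= G v by rewrite mulr_ge0// exprn_ge0.
have mG : measurable_fun `[(0 : R), +oo[ G.
  exact: (@measurable_step R (fun N => step_dens a mu x m N * (1 - K / m%:R) ^+ N)).
have dsub : `[0%R, d[%classic `<=` `[0%R, +oo[%classic by exact: subset_itvl.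
apply: (@le_trans _ _ (\int[leb]_(v in `[0%R, d[) (2%:E * (G v)%:E))%E).
  apply: ge0_le_integral => //.
  - by move=> v _; rewrite lee_fin mulr_ge0// exprn_ge0// subr_ge0 ler_pdivrMr// mul1r ler1n.
  - by apply/measurable_EFinP; exact: measurable_step_fun.
  - apply: measurable_funeM; apply/measurable_EFinP; exact: measurable_funS mG.
  - move=> v /=; rewrite in_itv/= => /andP[v0 vd]; rewrite -EFinM lee_fin.
    rewrite /step_fun /G mulrCA ler_wpM2l//; set N := Num.truncn _.
    apply: (@le_trans _ _ 1).
      by rewrite exprn_ile1 ?subr_ge0 ?ler_pdivrMr ?mul1r ?ler1n//.
    rewrite -ler_pdivrMl// mulr1.
    have /andP[NvM _] := truncn_itv (mulr_ge0 v0 (ltW m0')).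
    apply: (@le_trans _ _ (1 - N%:R * (K / m%:R))).
      suff : N%:R * (K / m%:R) <= 2^-1 by lra.
      rewrite mulrCA -ler_pdivlMl// ler_pdivrMr// (le_trans NvM)// ler_wpM2r//.
      rewrite /K invrK (le_trans (ltW vd))//; lra.
    by apply: bernoulli_ineq; rewrite divr_ge0 ?(ltW K0)//= ler_pdivrMr// mul1r.
apply: (@le_trans _ _ (\int[leb]_(v in `[0%R, +oo[) (2%:E * (G v)%:E))%E).
  apply: ge0_subset_integral => //.
    by apply: measurable_funeM; exact/measurable_EFinP.
  by move=> v _; rewrite -EFinM lee_fin mulr_ge0.
rewrite ge0_integralZl//; last 2 first.
- exact/measurable_EFinP.
- by move=> v _; rewrite lee_fin.
rewrite integral_step_dens ?K0// -EFinM lee_fin ler_wpM2l//.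
rewrite -[leRHS]mul1r; apply: ler_pM; rewrite ?powR_ge0//.
- rewrite exprn_ge0// subr_ge0 ler_pdivrMr// mul1r//.
- rewrite exprn_ile1// ?subr_ge0 ?ler_pdivrMr ?mul1r// gerBl divr_ge0// mulr_ge0 ?powR_ge0//.
- by rewrite /K -(powR_inv1 (mulr_ge0 _ (ltW d0)))// -powRrM mulN1r opprK.
Unshelve. all: by end_near. Qed.

(** The total integral is exactly (1 - x / m)^m. Split it at d: the head lies between 0 and 2 (2
    d)^mu for large m, the tail converges, and m -> oo leaves both bounds. *)
Lemma laplace_tail d : 0 < d ->
  ((expR (- x) - 2 * (2 * d) `^ mu)%:E <=
     \int[leb]_(v in `[d, +oo[) (laplace_fun v)%:E <= (expR (- x))%:E)%E.
Proof.
move=> d0; pose P m := (1 - x / m%:R) ^+ m.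
pose S m := (\int[leb]_(v in `[0%R, d[) (step_fun m v)%:E)%E.
pose A m := (\int[leb]_(v in `[d, +oo[) (step_fun m v)%:E)%E.
have cA : A @ \oo --> (\int[leb]_(v in `[d, +oo[) (laplace_fun v)%:E)%E.
  exact: step_fun_tail_cvg.
have cP : P @ \oo --> expR (- x).
  have := cvg_exprn_expR x0 ler01; rewrite mulr1.
  by rewrite (_ : (fun m => _) = P)//; apply/funext => m; rewrite mul1r natrK.
have dsub : `[0%R, d[%classic `<=` `[0%R, +oo[%classic by exact: subset_itvl.
have dsub' : `[d, +oo[%classic `<=` `[0%R, +oo[%classic.
  by apply: subset_itvr; rewrite bnd_simp ltW.
have [n0 _ n0P] : \forall m \near \oo, ((P m)%:E = S m + A m)%E /\ (0 <= S m)%E.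
  near=> m.
  have s0 : forall N, 0 <= step_dens a mu x m N by near: m; exact: step_dens_ge0.
  have m0 : (0 < m)%N by near: m; exact: nbhs_infty_gt.
  have f0 v : 0 <= step_fun m v.
    rewrite mulr_ge0// exprn_ge0// subr_ge0 ler_pdivrMr ?ltr0n// mul1r ler1n//.
  split; last by apply: integral_ge0 => v _; rewrite lee_fin.
  have := @integral_step_dens 1 m; rewrite ltr01 ler1n m0 => /(_ isT s0).
  rewrite !powR_one !mulr1 => <-; rewrite -/(step_fun m _).
  have E : `[0%R, +oo[%classic = `[0%R, d[%classic `|` `[d, +oo[%classic :> set R.
    rewrite -itv_bndbnd_setU// ?bnd_simp//; exact: ltW.
  rewrite E ge0_integral_setU//.
  - by rewrite -E; apply/measurable_EFinP; exact: measurable_step_fun.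
  - by move=> v _; rewrite lee_fin; exact: f0.
  - apply/disj_setPS => v [] /=; rewrite !in_itv/= andbT => /andP[_ vd] dv.
    by move: (lt_le_trans vd dv); rewrite ltxx.
have cPE : (fun m => (P m)%:E) @ \oo --> (expR (- x))%:E.
  by apply: cvg_EFin; [exact: nearW|exact: cP].
apply/andP; split.
- have c2 : (fun m => (P m - 2 * (2 * d) `^ mu)%:E) @ \oo -->
    (expR (- x) - 2 * (2 * d) `^ mu)%:E.
    apply: cvg_EFin; first exact: nearW.
    by apply: cvgB => //; exact: cvg_cst.
  apply: (lee_cvg_to c2 cA); near=> m.
  have [PE _] : ((P m)%:E = S m + A m)%E /\ (0 <= S m)%E.
    by apply: n0P; near: m; exact: nbhs_infty_ge.
  rewrite EFinB PE leeBlDl// leeD2r//.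
  by near: m; exact: step_fun_head.
- apply: (lee_cvg_to cA cPE); exists n0 => // m /n0P[-> S0].
  by rewrite leeDr.
Unshelve. all: by end_near. Qed.

Lemma laplace_wright :
  (\int[leb]_(v in `]0%R, +oo[) (laplace_fun v)%:E = (expR (- x))%:E)%E.
Proof.
pose F n : set R := `[n.+1%:R^-1, +oo[%classic.
have FE : \bigcup_n F n = `]0%R, +oo[%classic.
  apply/seteqP; split=> [v [n _]|v].
    by rewrite /F/= !in_itv/= !andbT; apply: lt_le_trans; rewrite invr_gt0.
  rewrite /= in_itv/= andbT => v0; exists (Num.truncn v^-1) => //.
  rewrite /F/= in_itv/= andbT -[leRHS]invrK lef_pV2 ?posrE ?invr_gt0//.
  by rewrite ltW// truncnS_gt.
have c1 : (fun n => \int[leb]_(v in F n) (laplace_fun v)%:E)%E @ \oo -->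
    (\int[leb]_(v in `]0%R, +oo[) (laplace_fun v)%:E)%E.
  rewrite -FE; apply: ge0_nondecreasing_set_cvg_integral.
  - move=> m n mn; rewrite subsetEset; apply: subset_itvr.
    by rewrite bnd_simp lef_pV2 ?posrE// ler_nat ltnS.
  - by move=> n; exact: measurable_itv.
  - by move=> n; apply/measurable_EFinP; exact: measurable_laplace_fun.
  - move=> n v; rewrite /F/= in_itv/= andbT => nv; rewrite lee_fin.
    by apply: laplace_fun_ge0; apply: lt_le_trans nv; rewrite invr_gt0.
have c2 : (fun n => \int[leb]_(v in F n) (laplace_fun v)%:E)%E @ \oo --> (expR (- x))%:E.
  apply: (@squeeze_cvge _ _ _ _
    (fun n => (expR (- x) - 2 * (2 * n.+1%:R^-1) `^ mu)%:E) _ (cst (expR (- x))%:E)).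
  - by apply: nearW => n; rewrite laplace_tail.
  - apply: cvg_EFin; first exact: nearW.
    rewrite -[in X in _ --> X](subr0 (expR (- x))).
    apply: cvgB; first exact: cvg_cst.
    rewrite -[in X in _ --> X](mulr0 2); apply: cvgMr.
    have /andP[mu0 _] := mu01.
    rewrite (_ : (fun n => _) = (fun n => 2 `^ mu * n.+1%:R `^ (- mu))); last first.
      apply/funext => n; rewrite powRM//; congr (_ * _).
      by rewrite -powR_inv1// -powRrM mulN1r.
    by rewrite -[in X in _ --> X](mulr0 (2 `^ mu)); apply: cvgMr; exact: cvg_powR_pinfty.
  - exact: cvg_cst.
exact: (cvg_unique _ c1 c2).
Qed.

End laplace.

(** * The law of the factor *)

Section changes_of_variables.
Context {R : realType}.
Notation leb := (@lebesgue_measure R).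
Implicit Types (c u v : R) (n : nat).

(** Substitution v = u^2 / 2 on the segments [posseg n] and their images; nonnegativity lets both
    sides increase to the integrals over the half-line. *)
Lemma ge0_integral_substitution_sqr (G : R -> R) :
  (forall v, 0 < v -> {for v, continuous G}) -> (forall v, 0 < v -> 0 <= G v) ->
  (\int[leb]_(v in `]0%R, +oo[) (G v)%:E =
   \int[leb]_(u in `]0%R, +oo[) (G (u ^+ 2 / 2) * u)%:E)%E.
Proof.
move=> cG G0; pose F u : R := u ^+ 2 / 2.
have F0 u : 0 < u -> 0 < F u by move=> u0; rewrite divr_gt0// exprn_gt0.
have dF u : is_derive u 1 F u.
  rewrite /F; apply: is_derive_eq; rewrite !scaler0 add0r.
  by transitivity (2^-1 * (u * 1 + u * 1)) => //; field.
have cF u : {for u, continuous F}.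
  by apply: differentiable_continuous; apply/derivable1_diffP; exact: ex_derive.
have F'E : (F^`())%classic = id by apply/funext => u; rewrite derive1E derive_val.
have mG : measurable_fun `](0 : R), +oo[ G.
  apply: open_continuous_measurable_fun; first exact: interval_open.
  by move=> v; rewrite inE/= in_itv/= andbT => /cG.
have mGF : measurable_fun `](0 : R), +oo[ (fun u => G (F u) * u).
  apply: open_continuous_measurable_fun; first exact: interval_open.
  move=> u; rewrite inE/= in_itv/= andbT => u0.
  apply: cvgM => //; apply: (cvg_comp F G (cF u)); exact: cG (F0 _ u0).
have c2 := cvg_integral_posseg (f := fun u => (G (F u) * u)%:E).
have {}c2 := c2 ((measurable_EFinP _ _).2 mGF).
pose H n : set R := `[F n.+2%:R^-1, F n.+2%:R]%classic.
have HE : \bigcup_n H n = `]0%R, +oo[%classic.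
  apply/seteqP; split=> [v [n _]|v].
    rewrite /H/= !in_itv/= andbT => /andP[+ _]; apply: lt_le_trans.
    by apply: F0; rewrite invr_gt0.
  rewrite /= in_itv/= andbT => v0; pose u := Num.sqrt (2 * v).
  have u0 : 0 < u by rewrite sqrtr_gt0 mulr_gt0.
  have Fu : F u = v.
    by rewrite /F /u sqr_sqrtr ?mulr_ge0 ?ltW// mulrAC divff// mul1r.
  have : (\bigcup_n posseg n) u by rewrite bigcup_posseg /= in_itv/= u0.
  move=> [n _]; rewrite /posseg/= in_itv/= => /andP[nu un]; exists n => //.
  rewrite /H/= in_itv/= -Fu /F; apply/andP; split; rewrite ler_pM2r ?invr_gt0//.
    by rewrite lerXn2r ?nnegrE ?invr_ge0// ltW.
  by rewrite lerXn2r ?nnegrE// ltW.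
have c1 : (fun n => \int[leb]_(v in H n) (G v)%:E)%E @ \oo -->
    (\int[leb]_(v in `]0%R, +oo[) (G v)%:E)%E.
  rewrite -HE; apply: ge0_nondecreasing_set_cvg_integral.
  - move=> m n mn; rewrite subsetEset; apply: subset_itv; rewrite bnd_simp /F.
      rewrite ler_pM2r ?invr_gt0// lerXn2r ?nnegrE ?invr_ge0//.
      by rewrite lef_pV2 ?posrE// ler_nat !ltnS.
    by rewrite ler_pM2r ?invr_gt0// lerXn2r ?nnegrE// ler_nat !ltnS.
  - by move=> n; exact: measurable_itv.
  - move=> n; apply/measurable_EFinP; apply: measurable_funS mG => //.
    by rewrite -HE; exact: bigcup_sup.
  - move=> n v Hv; rewrite lee_fin; apply: G0.
    have : (\bigcup_n H n) v by exists n.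
    by rewrite HE/= in_itv/= andbT.
apply: (cvg_unique _ c1) => //.
rewrite (_ : (fun n => _) = (fun n => \int[leb]_(u in posseg n) (G (F u) * u)%:E)%E).
  by apply: c2 => u u0; rewrite lee_fin mulr_ge0 ?(ltW u0)// G0// F0.
apply/funext => n.
have ab : n.+2%:R^-1 <= n.+2%:R :> R.
  by rewrite (@le_trans _ _ 1)// ?invf_le1 ?ler1n.
have a0 : 0 < n.+2%:R^-1 :> R by rewrite invr_gt0.
rewrite /H (@integration_by_substitution_increasing R F G) //.
- by rewrite F'E.
- move=> u v; rewrite !in_itv/= => /andP[au _] /andP[av _] uv.
  have u0 := lt_le_trans a0 au.
  by rewrite /F ltr_pM2r ?invr_gt0// ltrXn2r ?nnegrE// ltW// (lt_trans u0).
- by rewrite F'E => u _; exact: cvg_id.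
- by rewrite F'E; apply/cvg_ex; eexists; apply: cvg_at_right_filter; exact: cvg_id.
- by rewrite F'E; apply/cvg_ex; eexists; apply: cvg_at_left_filter; exact: cvg_id.
- by apply: derivable_LRcontinuous => // u _; exact: ex_derive.
- apply: continuous_in_subspaceT => v; rewrite inE/= in_itv/= => /andP[av _].
  by apply: cG; apply: lt_le_trans av; exact: F0.
Qed.

Lemma ge0_integral_even (f : R -> \bar R) : measurable_fun setT f ->
  (forall u, (0 <= f u)%E) -> (forall u, f (- u) = f u) ->
  (\int[leb]_u f u = 2%:E * \int[leb]_(u in `]0%R, +oo[) f u)%E.
Proof.
move=> mf f0 fN.
have mf' (D : set R) : measurable_fun D f by exact: measurable_funTS.
have D : `]-oo, 0%R]%classic `|` `]0%R, +oo[%classic = [set: R].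
  by rewrite -itv_bndbnd_setU// set_itvNyy.
rewrite -D ge0_integral_setU//=; last 2 first.
- exact: mf'.
- apply/disj_setPS => u [] /=; rewrite !in_itv/= andbT => u1 u2.
  by move: (le_lt_trans u1 u2); rewrite ltxx.
rewrite mule_natl mule2n; congr (_ + _)%E.
have -> : (\int[leb]_(u in `]-oo, 0%R]) f u = \int[leb]_(u in `]-oo, 0%R]) f (- u)%R)%E.
  by apply: eq_integral => u _; rewrite fN.
by rewrite -ge0_integration_by_substitution0// integral_itv_obnd_cbnd.
Qed.

(** Uniqueness of Lebesgue measure: c times its image under u -> c u gives half-open intervals their
    length. The lemma is applied to integrands containing indicators of arbitrary measurable sets,
    so f is only measurable. *)
Lemma ge0_integral_scale c (f : R -> \bar R) : 0 < c -> measurable_fun setT f ->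
  (forall u, (0 <= f u)%E) ->
  (\int[leb]_u f u = \int[leb]_u (c%:E * f (c * u)%R))%E.
Proof.
move=> c0 mf f0.
pose phi : measurableTypeR R -> measurableTypeR R := fun u => c * u.
have mphi : measurable_fun setT phi by exact: measurable_funM.
pose pm : {measure set (measurableTypeR R) -> \bar R} :=
  measure_function_pushforward__canonical__measure_function_Measure leb mphi.
pose k : {nonneg R} := NngNum (ltW c0).
transitivity (\int[mscale k pm]_u f u)%E.
  apply: eq_measure_integral => A mA _.
  apply: lebesgue_measure_unique => // _ [[a b]] _ <-.
  have E : phi @^-1` `]a, b] = `]c^-1 * a, c^-1 * b]%classic.
    by apply/seteqP; split=> u; rewrite /= /phi !in_itv/= ltr_pdivrMl// ler_pdivlMl.
  transitivity (c%:E * leb (phi @^-1` `]a, b]))%E; last by [].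
  rewrite E !lebesgue_measure_itv/= !lte_fin ltr_pM2l ?invr_gt0//.
  case: ifPn => _; last by rewrite mule0.
  by rewrite -!EFinB -EFinM -mulrBr mulVKf// gt_eqF.
rewrite ge0_integral_mscale//= ge0_integral_pushforward//= preimage_setT.
rewrite -ge0_integralZl//=.
  exact: (measurableT_comp mf).
by rewrite lee_fin ltW.
Qed.

End changes_of_variables.

(** Measurability and nonnegativity of f are arguments so that a measure structure can be attached
    to this set function. *)
Definition density_measure d (T : measurableType d) (R : realType)
    (m : {measure set T -> \bar R}) (f : T -> R)
    of measurable_fun setT f & (forall t, 0 <= f t) := fun A : set T =>
  (\int[m]_(t in A) (f t)%:E)%E.

Section density_measure.
Local Open Scope ereal_scope.
Context d (T : measurableType d) (R : realType) (m : {measure set T -> \bar R}).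
Variables (f : T -> R) (mf : measurable_fun setT f) (f0 : forall t, (0 <= f t)%R).

Let nu := density_measure m mf f0.

Let density_measure0 : nu set0 = 0.
Proof. by rewrite /nu /density_measure integral_set0. Qed.

Let density_measure_ge0 A : 0 <= nu A.
Proof. by apply: integral_ge0 => t _; rewrite lee_fin. Qed.

Let density_measure_sigma_additive : semi_sigma_additive nu.
Proof.
move=> F mF tF mUF; rewrite /nu /density_measure; apply: cvg_toP.
  apply: ereal_nondecreasing_is_cvgn => i j ij.
  apply: lee_sum_nneg_natr => // k _ _; apply: integral_ge0 => t _.
  by rewrite lee_fin.
rewrite ge0_integral_bigcup//=.
- by apply/measurable_EFinP; exact: measurable_funTS.
- by move=> t _; rewrite lee_fin.
Qed.

HB.instance Definition _ := isMeasure.Build _ _ _ nu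
  density_measure0 density_measure_ge0 density_measure_sigma_additive.

End density_measure.

Section factor_density.
Context {R : realType}.
Notation leb := (@lebesgue_measure R).
Variables (a : R) (a01 : 0 < a < 1).
Implicit Types (t u v x y : R).

Let mu := (1 - a) / 2.

Let mu01 : 0 < mu < 1.
Proof. by have /andP[? ?] := a01; rewrite /mu; apply/andP; split; lra. Qed.

Local Notation phi := (@normal_pdf R 0 1).

Lemma normal_pdf01E u : phi u = normal_peak 1 * expR (- (u ^+ 2 / 2)) :> R.
Proof. by rewrite normal_pdfE ?oner_eq0// /normal_fun subr0 expr1n mulNr. Qed.

Lemma measurable_rho : measurable_fun setT (rho a).
Proof.
apply: measurable_funM => //; apply: measurableT_comp.
  by apply: continuous_measurable_fun; exact: continuous_wright.
by apply: measurable_funM => //; exact: measurable_funX.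
Qed.

Lemma rho_ge0 t : 0 < t -> 0 <= rho a t.
Proof.
move=> t0; rewrite /rho mulr_ge0 ?powR_ge0//.
(* Positivity of the scaling limit is used at v = 1, with this value for x. *)
have x0 : 0 <= 2 `^ (a - 1) * t ^+ 2 by rewrite mulr_ge0 ?powR_ge0 ?exprn_ge0 ?ltW.
have := weighted_wright_ge0 a01 mu01 x0 (@ltr01 R).
by rewrite !powR_one mul1r mulr1 mulNr.
Qed.

(* The change of variable v = u ^ 2 / 2 in the Laplace integral at x = y ^ 2 / 2. *)
Lemma rho_laplace_fun y u : 0 < y -> 0 < u ->
  phi u * (rho a (y * u `^ (- a)) * u `^ (- a)) =
  normal_peak 1 * (laplace_fun a mu (y ^+ 2 / 2) (u ^+ 2 / 2) * u).
Proof.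
move=> y0 u0; rewrite normal_pdf01E /rho /laplace_fun -/mu.
have h0 : 0 <= 2^-1 :> R by rewrite invr_ge0.
have sqrP p : (u ^+ 2) `^ p = (u `^ p) ^+ 2.
  by rewrite -(powR_mulrn 2 (ltW u0)) -(powR_mulrn 2 (powR_ge0 u p)) -!powRrM mulrC.
have halfP p : 2^-1 `^ p = 2 `^ (- p) :> R by rewrite -powR_inv1// -powRrM mulN1r.
have -> : - 2 `^ (a - 1) * (y * u `^ (- a)) ^+ 2 =
    - (y ^+ 2 / 2) * (u ^+ 2 / 2) `^ (- a).
  rewrite (powRM _ (exprn_ge0 2 (ltW u0)) h0) sqrP halfP opprK exprMn.
  have -> : 2 `^ (a - 1) = 2 `^ a / 2 :> R.
    by rewrite powRD_gt0// powR_inv1.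
  by ring.
rewrite (powRM (mu - 1) (exprn_ge0 2 (ltW u0)) h0) sqrP halfP.
have -> : - (mu - 1) = (1 + a) / 2 by rewrite /mu; field.
(* Here the value of mu enters: 2 (mu - 1) + 1 = - a. *)
have -> : u `^ (- a) = (u `^ (mu - 1)) ^+ 2 * u.
  rewrite -powR_mulrn ?powR_ge0// -powRrM -[X in _ * X](powRr1 (ltW u0)) -powRD_gt0//.
  by congr (_ `^ _); rewrite /mu; field.
by ring.
Qed.

Lemma continuous_laplace_fun x v : 0 < v -> {for v, continuous (laplace_fun a mu x)}.
Proof.
move=> v0; rewrite /laplace_fun.
apply: cvgM; last first.
  apply: (cvg_comp (@GRing.opp R) expR); last exact: continuous_expR.
  exact: opp_continuous.
apply: cvgM; first exact: continuous_powR.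
apply: (cvg_comp (fun v => - x * v `^ (- a)) (wright (- a) mu)).
  by apply: cvgMr; exact: continuous_powR.
exact: continuous_wright.
Qed.

Lemma integral_rho_kernel y : 0 < y ->
  (\int[leb]_(u in `]0%R, +oo[) (phi u * (rho a (y * u `^ (- a)) * u `^ (- a)))%:E =
   (phi y)%:E)%E.
Proof.
move=> y0; have x0 : 0 <= y ^+ 2 / 2 by rewrite divr_ge0// exprn_ge0// ltW.
transitivity (\int[leb]_(u in `]0%R, +oo[) ((normal_peak 1)%:E *
    (laplace_fun a mu (y ^+ 2 / 2) (u ^+ 2 / 2) * u)%:E))%E.
  apply: eq_integral => u; rewrite inE/= in_itv/= andbT => u0.
  by rewrite rho_laplace_fun.
have ge0 v : 0 < v -> 0 <= laplace_fun a mu (y ^+ 2 / 2) v.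
  by move=> v0; exact: laplace_fun_ge0.
rewrite ge0_integralZl//; last 3 first.
- apply/measurable_EFinP; apply: measurable_funM => //.
  apply: (measurableT_comp (f := laplace_fun a mu (y ^+ 2 / 2))).
    exact: measurable_laplace_fun.
  by apply: measurable_funM => //; exact: measurable_funX.
- move=> u /=; rewrite in_itv/= andbT => u0; rewrite lee_fin mulr_ge0 ?(ltW u0)//.
  by apply: ge0; rewrite divr_gt0// exprn_gt0.
- by rewrite lee_fin normal_peak_ge0.
rewrite -ge0_integral_substitution_sqr//; last exact: continuous_laplace_fun.
by rewrite laplace_wright// -EFinM normal_pdf01E.
Qed.

(** As a formula [rho a] is even in t, so it must be cut off to be a density on the whole line. *)
Definition rho_ext : R -> R := rho a \_ `]0%R, +oo[%classic.

Lemma rho_ext_ge0 t : 0 <= rho_ext t.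
Proof.
rewrite /rho_ext patchE; case: ifPn => //.
by rewrite inE/= in_itv/= andbT; exact: rho_ge0.
Qed.

Lemma measurable_rho_ext : measurable_fun setT rho_ext.
Proof.
apply/measurable_restrict => //.
by rewrite setTI; apply: measurable_funTS; exact: measurable_rho.
Qed.

(** For fixed u put x = u^(-a) y, exchange the integrals, and [integral_rho_kernel] evaluates the
    inner one. The case f = 1 gives the mass of rho, the indicator of a set the identity in law. *)
Lemma normal_rho_swap (f : R -> R) : measurable_fun setT f -> (forall y, 0 <= f y) ->
  (\int[leb]_(u in `]0%R, +oo[) ((phi u)%:E *
      \int[leb]_x (f (u `^ a * x) * rho_ext x)%:E) =
   \int[leb]_(y in `]0%R, +oo[) (f y * phi y)%:E)%E.
Proof.
move=> mf f0.
pose D := `]0%R, +oo[%classic : set R.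
(* The indicator of D extends the integrand to the whole plane, where Tonelli's theorem is
   applied. *)
pose k (z : R * R) := \1_D z.1 * (phi z.1 * (z.1 `^ (- a) *
  (f z.2 * rho_ext (z.1 `^ (- a) * z.2)))).
have mfst : measurable_fun setT (fun z : R * R => z.1 `^ (- a)).
  by apply: (measurableT_comp (measurable_powR (- a))); exact: measurable_fst.
have mk : measurable_fun setT k.
  apply: measurable_funM.
    have mD : measurable_fun setT (\1_D : R -> R).
      by apply: measurable_indic; exact: measurable_itv.
    exact: (measurableT_comp mD measurable_fst).
  apply: measurable_funM.
    exact: (measurableT_comp (measurable_normal_pdf 0 1) measurable_fst).
  apply: measurable_funM => //; apply: measurable_funM.
    exact: (measurableT_comp mf measurable_snd).
  have msnd : measurable_fun setT (fun z : R * R => z.1 `^ (- a) * z.2).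
    by apply: measurable_funM => //; exact: measurable_snd.
  exact: (measurableT_comp measurable_rho_ext msnd).
have k0 z : 0 <= k z.
  by rewrite !mulr_ge0 ?powR_ge0 ?normal_pdf_ge0 ?f0 ?rho_ext_ge0.
transitivity (\int[leb]_u \int[leb]_y (k (u, y))%:E)%E.
  rewrite integral_mkcond; apply: eq_integral => u _; rewrite patchE.
  case: ifPn => uD; last first.
    rewrite integral0_eq// => y _; rewrite /k/= indicE.
    by rewrite (negbTE uD) mul0r.
  have u0 : 0 < u by move: uD; rewrite inE/= in_itv/= andbT.
  have c0 : 0 < u `^ (- a) by rewrite powR_gt0.
  have mg : measurable_fun setT (fun x => f (u `^ a * x) * rho_ext x).
    apply: measurable_funM; last exact: measurable_rho_ext.
    by apply: measurableT_comp => //; exact: measurable_funM.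
  have g0 x : 0 <= f (u `^ a * x) * rho_ext x by rewrite mulr_ge0 ?f0 ?rho_ext_ge0.
  rewrite (ge0_integral_scale (f := fun x => (f (u `^ a * x) * rho_ext x)%:E) c0)//.
  2: exact/measurable_EFinP.
  rewrite -ge0_integralZl//; last 3 first.
  - apply: measurable_funeM; apply/measurable_EFinP.
    by apply: (measurableT_comp mg); exact: measurable_funM.
  - by move=> x _; rewrite -EFinM lee_fin mulr_ge0// ltW.
  - by rewrite lee_fin normal_pdf_ge0.
  apply: eq_integral => y _; rewrite -!EFinM; congr EFin.
  have -> : u `^ a * (u `^ (- a) * y) = y.
    by rewrite mulrA -powRD_gt0// subrr powRr0 mul1r.
  by rewrite /k/= indicE uD mul1r.
transitivity (\int[leb]_y \int[leb]_u (k (u, y))%:E)%E.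
  apply: (@fubini_tonelli _ _ (measurableTypeR R) (measurableTypeR R) R leb leb
    (EFin \o k)) => [|z]; last by rewrite lee_fin.
  exact/measurable_EFinP.
rewrite [RHS]integral_mkcond; apply: eq_integral => y _; rewrite patchE/=.
transitivity (\int[leb]_(u in D)
    ((f y)%:E * (phi u * (rho_ext (u `^ (- a) * y) * u `^ (- a)))%:E))%E.
  rewrite [RHS]integral_mkcond; apply: eq_integral => u _; rewrite patchE.
  rewrite /k/= indicE; case: ifPn => _; last by rewrite mul0r.
  by rewrite mul1r -EFinM; congr EFin; ring.
rewrite ge0_integralZl//; last 3 first.
- apply/measurable_EFinP; apply: measurable_funTS; apply: measurable_funM.
    exact: measurable_normal_pdf.
  apply: measurable_funM; last exact: measurable_powR.
  have my : measurable_fun setT (fun u => u `^ (- a) * y).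
    by apply: measurable_funM => //; exact: measurable_powR.
  exact: (measurableT_comp measurable_rho_ext my).
- by move=> u _; rewrite lee_fin !mulr_ge0 ?normal_pdf_ge0 ?rho_ext_ge0 ?powR_ge0.
- by rewrite lee_fin.
case: ifPn => yD; last first.
  rewrite integral0_eq ?mule0// => u; rewrite /D/= in_itv/= andbT => u0.
  rewrite /rho_ext patchE ifF ?mul0r ?mulr0//; apply/negbTE; apply: contra yD.
  by rewrite !inE/= !in_itv/= !andbT pmulr_rgt0// powR_gt0.
have y0 : 0 < y by move: yD; rewrite inE/= in_itv/= andbT.
  rewrite EFinM -integral_rho_kernel//; congr (_ * _)%E; apply: eq_integral => u.
  rewrite inE /D/= in_itv/= andbT => u0; rewrite /rho_ext patchE ifT; last first.
    by rewrite inE/= in_itv/= andbT mulr_gt0// powR_gt0.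
  by rewrite (mulrC y).
exact: measurable_itv.
Qed.

End factor_density.

(** * Joint law of independent variables with densities *)

Section joint_law.
Local Open Scope ereal_scope.
Context {R : realType}.
Notation leb := (@lebesgue_measure R).

(** The law of (U, X) and the measure with density f(u) g(x) both agree with the product of m1 and
    m2 on rectangles, so uniqueness of the product measure identifies them. *)
Lemma joint_law_density d (T : measurableType d) (P : probability T R)
    (U X : {RV P >-> R}) (m1 m2 : probability (measurableTypeR R) R) (f g : R -> R) :
  measurable_fun setT f -> (forall t, 0 <= f t)%R ->
  measurable_fun setT g -> (forall t, 0 <= g t)%R ->
  (forall A, measurable A -> m1 A = \int[leb]_(t in A) (f t)%:E) ->
  (forall A, measurable A -> m2 A = \int[leb]_(t in A) (g t)%:E) ->
  (forall A, measurable A -> distribution P U A = m1 A) ->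
  (forall A, measurable A -> distribution P X A = m2 A) ->
  independent_RV U X ->
  forall C : set (R * R), measurable C ->
  P [set w | C (U w, X w)] =
  \int[leb]_u \int[leb]_x (\1_C (u, x) * (f u * g x))%:E.
Proof.
move=> mf f0 mg g0 m1f m2g Um1 Xm2 UX C mC.
pose h (z : R * R) : R := (f z.1 * g z.2)%R.
have mh : measurable_fun setT h.
  apply: measurable_funM.
    exact: (measurableT_comp mf measurable_fst).
  exact: (measurableT_comp mg measurable_snd).
have h0 z : (0 <= h z)%R by rewrite mulr_ge0.
pose leb2 : {measure set (measurableTypeR R * measurableTypeR R) -> \bar R} :=
  (leb \x leb)%E.
have swap (A : set (R * R)) : measurable A -> density_measure leb2 mh h0 A =
    \int[leb]_u \int[leb]_x (\1_A (u, x) * (f u * g x))%:E.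
  move=> mA; rewrite /density_measure integral_mkcond.
  transitivity (\int[leb2]_z (\1_A z * h z)%:E).
    apply: eq_integral => z _; rewrite patchE indicE.
    by case: ifPn => _; rewrite ?mul1r ?mul0r.
  apply: (@fubini_tonelli1 _ _ (measurableTypeR R) (measurableTypeR R) R leb leb
    (fun z => (\1_A z * h z)%:E)) => [|z]; last by rewrite lee_fin mulr_ge0.
  by apply/measurable_EFinP; apply: measurable_funM => //; exact: measurable_indic.
have mUX : measurable_fun setT
    (fun w => (U w, X w) : measurableTypeR R * measurableTypeR R).
  have mRV (V : {RV P >-> R}) : measurable_fun setT (V : T -> measurableTypeR R).
    exact: (measurable_funPT V).
  exact: (measurable_fun_pair (mRV U) (mRV X)).
pose joint : {measure set (measurableTypeR R * measurableTypeR R) -> \bar R} :=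
  measure_function_pushforward__canonical__measure_function_Measure P mUX.
rewrite -swap//.
transitivity ((m1 \x m2)%E C).
  symmetry; apply: (product_measure_unique (m' := joint)) => // A B mA mB.
  by rewrite /joint/= /pushforward/= -Um1// -Xm2//; exact: UX.
apply: (product_measure_unique (m' := density_measure leb2 mh h0)) => // A B mA mB.
transitivity (\int[leb]_u \int[leb]_x (\1_(A `*` B) (u, x) * (f u * g x))%:E).
  exact: (swap (A `*` B) (measurableX mA mB)).
transitivity (\int[leb]_u ((\1_A u * f u)%:E * m2 B)).
  apply: eq_integral => u _; rewrite m2g// (integral_mkcond B).
  rewrite -ge0_integralZl//; last 3 first.
  - apply/(measurable_restrictT _ _).1 => //.
    by apply/measurable_EFinP; exact: measurable_funTS.
  - by move=> x _; rewrite patchE; case: ifPn => // _; rewrite lee_fin.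
  - by rewrite lee_fin mulr_ge0.
  apply: eq_integral => x _; rewrite patchE !indicE in_setX/=.
  by case: ifPn => _; rewrite ?andbT ?andbF ?mule0 ?mul0r// -EFinM mulrA.
transitivity ((\int[leb]_(t in A) (f t)%:E) * m2 B); last first.
  by congr (_ * _); symmetry; exact: m1f.
rewrite (integral_mkcond A) ge0_integralZr//; last 2 first.
- apply/measurable_EFinP; apply: measurable_funM => //; exact: measurable_indic.
- by move=> u _; rewrite lee_fin mulr_ge0.
congr (_ * _); apply: eq_integral => u _; rewrite patchE indicE.
by case: ifPn => _; rewrite ?mul1r ?mul0r.
Qed.

End joint_law.

(** * Total mass, existence of the pair, and the identity in law *)

Section factor_law.
Local Open Scope ereal_scope.
Context {R : realType}.
Notation leb := (@lebesgue_measure R).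
Local Notation phi := (@normal_pdf R 0%R 1%R).
Variables (a : R) (a01 : (0 < a < 1)%R).

Lemma integral_normal_pdf_gt0 : \int[leb]_(u in `]0%R, +oo[) (phi u)%:E = (2^-1)%:E.
Proof.
have := integral_normal_pdf (0 : R) 1.
rewrite ge0_integral_even/=; last 3 first.
- by apply/measurable_EFinP; exact: measurable_normal_pdf.
- by move=> u; rewrite lee_fin normal_pdf_ge0.
- by move=> u; rewrite !normal_pdf01E sqrrN.
case: (integral _ _ _) => [r| |].
- by move=> [] h; congr EFin; lra.
- by rewrite gt0_muley.
- by rewrite gt0_muleNy.
Qed.

Lemma integral_rho_ext : \int[leb]_x (rho_ext a x)%:E = 1.
Proof.
(* With f = 1 the identity says that half the mass of [rho_ext a] is 1 / 2. *)
have := normal_rho_swap a01 (@measurable_cst _ _ _ _ setT (1%R : R)) (fun=> ler01).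
under eq_integral do under eq_integral do rewrite mul1r.
under [X in _ = X]eq_integral do rewrite mul1r.
rewrite ge0_integralZr//; last 3 first.
- by apply/measurable_EFinP; apply: measurable_funTS; exact: measurable_normal_pdf.
- by move=> u _; rewrite lee_fin normal_pdf_ge0.
- by apply: integral_ge0 => x _; rewrite lee_fin rho_ext_ge0.
rewrite integral_normal_pdf_gt0.
case: (integral _ _ _) => [r| |].
- by move=> [] h; congr EFin; lra.
- by rewrite gt0_muley// lte_fin invr_gt0.
- by rewrite gt0_muleNy// lte_fin invr_gt0.
Qed.

Lemma integral_rho_extE (A : set R) :
  \int[leb]_(t in A) (rho_ext a t)%:E = \int[leb]_(t in A `&` `]0%R, +oo[) (rho a t)%:E.
Proof.
rewrite integral_mkcondr; apply: eq_integral => t _.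
by rewrite /rho_ext !patchE; case: ifPn.
Qed.

Lemma is_pdf_on_rho : is_pdf_on `]0%R, +oo[ (rho a).
Proof.
split; first exact: measurable_funTS (measurable_rho a01).
- by move=> t /=; rewrite in_itv/= andbT; exact: rho_ge0.
- by rewrite -[X in integral _ X]setTI -integral_rho_extE integral_rho_ext.
Qed.

Definition rho_prob : set (measurableTypeR R) -> \bar R :=
  density_measure leb (measurable_rho_ext a01) (rho_ext_ge0 a01).

HB.instance Definition _ := Measure.on rho_prob.

HB.instance Definition _ :=
  Measure_isProbability.Build _ _ _ rho_prob integral_rho_ext.

Lemma rho_probE A : rho_prob A = \int[leb]_(t in A `&` `]0%R, +oo[) (rho a t)%:E.
Proof. exact: integral_rho_extE. Qed.


(** Ensures that the identity in law is not vacuous: the coordinates on the plane under the product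
    law form such a pair. *)
Lemma normal_and_factor_exists : exists (d : measure_display) (T : measurableType d)
  (P : probability T R) (U X : {RV P >-> R}), normal_and_factor a U X.
Proof.
pose P : probability (measurableTypeR R * measurableTypeR R)%type R :=
  ((normal_prob 0%R 1%R : probability (measurableTypeR R) R) \x rho_prob)%E.
have mU : measurable_fun setT (fst : measurableTypeR R * measurableTypeR R -> R).
  exact: measurable_fst.
have mX : measurable_fun setT (snd : measurableTypeR R * measurableTypeR R -> R).
  exact: measurable_snd.
pose U : {RV P >-> R} :=
  @mfun_Sub _ _ (measurableTypeR R * measurableTypeR R)%type R _ (mem_set mU).
pose X : {RV P >-> R} :=
  @mfun_Sub _ _ (measurableTypeR R * measurableTypeR R)%type R _ (mem_set mX).
have PE A B : measurable A -> measurable B ->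
    P (A `*` B) = normal_prob 0%R 1%R A * rho_prob B.
  by move=> mA mB; exact: product_measure1E.
have UE A : measurable A -> distribution P U A = normal_prob 0%R 1%R A.
  move=> mA; transitivity (P (A `*` setT)).
    by rewrite setXT.
  by rewrite PE// probability_setT mule1.
have XE A : measurable A -> distribution P X A = rho_prob A.
  move=> mA; transitivity (P (setT `*` A)).
    by rewrite setTX.
  by rewrite PE// probability_setT mul1e.
exists _, _, P, U, X; split.
- exact: UE.
- exists (X @^-1` `]-oo, 0%R]); split.
  + by apply: measurable_funPTI; exact: measurable_itv.
  + rewrite -[LHS]/(distribution P X `]-oo, 0%R]) XE ?rho_probE; last exact: measurable_itv.
    rewrite (_ : _ `&` _ = set0) ?integral_set0//; apply/seteqP; split=> // t [] /=.
    by rewrite !in_itv/= andbT leNgt => /negP.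
  + by move=> w /= /negP; rewrite in_itv/= -leNgt.
- move=> A B mA mB; rewrite -[P (U @^-1` A)]/(distribution P U A).
  rewrite -[P (X @^-1` B)]/(distribution P X B) UE// XE// -PE//.
- by move=> A mA; rewrite XE// rho_probE.
Qed.

Lemma normal_and_factor_eq_in_law d (T : measurableType d) (P : probability T R)
    (U X : {RV P >-> R}) : normal_and_factor a U X ->
  eq_in_law P (fun w => `|U w|%R) (fun w => `|U w| `^ a * X w)%R.
Proof.
move=> [sU _ UX dX] A mA.
have mphi := @measurable_normal_pdf R 0 1.
have phi0 u : (0 <= phi u)%R by exact: normal_pdf_ge0.
have phiN u : phi (- u) = phi u by rewrite !normal_pdf01E sqrrN.
have mabs : measurable_fun setT (fun u : R => `|u|%R) by exact: normr_measurable.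
have mA1 : measurable_fun setT (\1_A : R -> R) by exact: measurable_indic.
pose C : set (R * R) := [set z | A (`|z.1| `^ a * z.2)%R].
have mpow : measurable_fun setT (fun z : R * R => `|z.1| `^ a * z.2)%R.
  apply: measurable_funM; last exact: measurable_snd.
  exact: (measurableT_comp (measurableT_comp (measurable_powR a) mabs) measurable_fst).
have mC : measurable C by rewrite -[C]setTI; exact: mpow.
pose F u := \int[leb]_x (\1_C (u, x) * (phi u * rho_ext a x))%:E.
(* Both laws are brought to this half-line integral: the left one by evenness of phi, the right one
   by evenness in u of its double integral and [normal_rho_swap]. *)
transitivity (2%:E * \int[leb]_(u in `]0%R, +oo[) (\1_A u * phi u)%:E).
  pose B : set R := [set u | A `|u|%R].
  have mB : measurable B by rewrite -[B]setTI; exact: mabs.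
  transitivity (distribution P U B); first by [].
  rewrite sU// /normal_prob integral_mkcond.
  transitivity (\int[leb]_u (\1_A `|u|%R * phi u)%:E).
    apply: eq_integral => u _; rewrite patchE indicE.
    rewrite (_ : (u \in _) = (`|u|%R \in A)); last by apply/idP/idP; rewrite !inE.
    by case: ifPn => _; rewrite ?mul1r ?mul0r.
  rewrite ge0_integral_even; last 3 first.
  - apply/measurable_EFinP; apply: measurable_funM => //.
    exact: (measurableT_comp mA1 mabs).
  - by move=> u; rewrite lee_fin mulr_ge0.
  - by move=> u; rewrite normrN phiN.
  congr (_ * _); apply: eq_integral => u; rewrite inE/= in_itv/= andbT => u0.
  by rewrite gtr0_norm.
symmetry; transitivity (\int[leb]_u F u).
  apply: (joint_law_density (m1 := normal_prob 0%R 1%R) (m2 := rho_prob)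
    mphi phi0 (measurable_rho_ext a01) (rho_ext_ge0 a01)) => //.
  by move=> B mB; exact: etrans (dX B mB) (esym (rho_probE B)).
(* F is even because C depends on its first coordinate only through the absolute value. *)
rewrite ge0_integral_even; last 3 first.
- have mk : measurable_fun setT
      (fun z : R * R => \1_C z * (phi z.1 * rho_ext a z.2))%R.
    apply: measurable_funM; first exact: measurable_indic.
    apply: measurable_funM; first exact: (measurableT_comp mphi measurable_fst).
    exact: (measurableT_comp (measurable_rho_ext a01) measurable_snd).
  apply: (@measurable_fun_fubini_tonelli_F _ _ (measurableTypeR R) (measurableTypeR R)
    R leb (fun z => (\1_C z * (phi z.1 * rho_ext a z.2))%:E)) => [|z].
    exact/measurable_EFinP.
  by rewrite lee_fin !mulr_ge0// rho_ext_ge0.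
- move=> u; apply: integral_ge0 => x _.
  by rewrite lee_fin !mulr_ge0// rho_ext_ge0.
- move=> u; apply: eq_integral => x _; rewrite phiN !indicE.
  rewrite (_ : (((- u)%R, x) \in C) = ((u, x) \in C))//.
  by apply/idP/idP; rewrite !inE /C/= normrN.
congr (_ * _); rewrite -(normal_rho_swap a01)//.
apply: eq_integral => u; rewrite inE/= in_itv/= andbT => u0.
rewrite -ge0_integralZl//; last 3 first.
- apply/measurable_EFinP; apply: measurable_funM; last exact: measurable_rho_ext.
  by apply: (measurableT_comp mA1); exact: measurable_funM.
- by move=> x _; rewrite lee_fin mulr_ge0// rho_ext_ge0.
- by rewrite lee_fin.
apply: eq_integral => x _; rewrite -EFinM !indicE.
rewrite (_ : ((u, x) \in C) = (u `^ a * x \in A))%R; last first.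
  by apply/idP/idP; rewrite !inE /C/= gtr0_norm.
by congr EFin; ring.
Qed.

End factor_law.

Theorem theorem4p1 (R : realType) (alpha : R) (alpha01 : 0 < alpha < 1) :
  [/\ is_pdf_on `]0, +oo[ (rho alpha),
      (exists (d : measure_display) (T : measurableType d)
              (P : probability T R) (U X : {RV P >-> R}),
         normal_and_factor alpha U X) &
      (forall (d : measure_display) (T : measurableType d)
              (P : probability T R) (U X : {RV P >-> R}),
         normal_and_factor alpha U X ->
         eq_in_law P (fun w => `|U w|) (fun w => `|U w| `^ alpha * X w))].
Proof.
split.
- exact: is_pdf_on_rho.
- exact: normal_and_factor_exists.
- by move=> d T P U X; exact: normal_and_factor_eq_in_law.
Qed.
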